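(* Let $d\ge 1$. There exists a constant $C>0$, depending only on the dimension $d$, such that for all $u\in H^1(B_1)$, $$ |\{u\le 1/2\}\cap B_1|\cdot|\{u\ge 1\}\cap B_1|\;\le\; C\,\|\nabla_x u\|_{L^2(B_1)}\,|\{1/2<u<1\}\cap B_1|^{1/2}.$$
   Context: $B_1$ is the open unit ball of $\mathbb{R}^d$ centered at the origin, $H^1(B_1)$ is the Sobolev space of real-valued $L^2$ functions with weak gradient in $L^2$, and $|E|$ is the Lebesgue measure of $E$. *)

(* Defs.v *)
From HB Require Import structures.
From mathcomp Require Import all_boot all_order all_algebra.
From mathcomp Require Import all_classical all_reals all_analysis.
Import Order.TTheory GRing.Theory Num.Theory.
Import numFieldNormedType.Exports.

Set Implicit Arguments.
Unset Strict Implicit.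
Unset Printing Implicit Defensive.

Local Open Scope classical_set_scope.
Local Open Scope ring_scope.

Definition rV_display : measure_display. Proof. exact: default_measure_display. Qed.

(* 'rV[R]_n carries the sigma-algebra generated by the coordinate maps, i.e. the
   Borel one. *)
Section measurable_rV.
Context {R : realType} {n : nat}.

Let coord (i : 'I_n) (x : 'rV[R]_n) : measurableTypeR R := x ord0 i.

Let rV_set0 : g_sigma_preimage coord set0.
Proof. exact: sigma_algebra0. Qed.

Let rV_setC A : g_sigma_preimage coord A -> g_sigma_preimage coord (~` A).
Proof. exact: sigma_algebraC. Qed.

Let rV_bigcup (F : (set 'rV[R]_n)^nat) :
  (forall i, g_sigma_preimage coord (F i)) ->
  g_sigma_preimage coord (\bigcup_i F i).
Proof. exact: sigma_algebra_bigcup. Qed.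

HB.instance Definition _ := @isMeasurable.Build rV_display
  'rV[R]_n (g_sigma_preimage coord) rV_set0 rV_setC rV_bigcup.

Lemma measurable_coord (i : 'I_n) :
  measurable_fun [set: 'rV[R]_n] (fun x : 'rV[R]_n => x ord0 i).
Proof.
move=> _ Y mY; rewrite setTI; apply: sub_sigma_algebra => /=.
rewrite -bigcup_seq/=; exists i => /=; first by rewrite mem_index_enum.
by exists Y => //; rewrite setTI.
Qed.

Lemma measurable_fun_rVP d (T : measurableType d) (f : T -> 'rV[R]_n) :
  (forall i, measurable_fun [set: T] (fun t => f t ord0 i)) ->
  measurable_fun [set: T] f.
Proof.
move=> mf; suff prefS : g_sigma_preimage (fun i => coord i \o f) `<=` measurable.
  move=> _ A mA; apply: prefS; rewrite g_sigma_preimage_comp.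
  by exists A.
apply: smallest_sub; first exact: sigma_algebra_measurable.
move=> A; rewrite -bigcup_seq/= => -[i _ [B mB <-]].
exact: mf.
Qed.

End measurable_rV.

Definition rV_cons (R : realType) n (p : 'rV[R]_n * measurableTypeR R) :
  'rV[R]_n.+1 := \row_i oapp (p.1 ord0) p.2 (unlift ord0 i).

Lemma measurable_rV_cons (R : realType) n :
  measurable_fun [set: 'rV[R]_n * measurableTypeR R] (@rV_cons R n).
Proof.
apply: measurable_fun_rVP => i.
under eq_fun do rewrite mxE.
case: (unlift ord0 i) => [j|] /=; last exact: measurable_snd.
by apply: (measurableT_comp (@measurable_coord R n j)); exact: measurable_fst.
Qed.

Definition rV_uncons (R : realType) n (x : 'rV[R]_n.+1) :
  'rV[R]_n * measurableTypeR R := (\row_j x ord0 (lift ord0 j), x ord0 ord0).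

Lemma rV_consK (R : realType) n : cancel (@rV_cons R n) (@rV_uncons R n).
Proof.
move=> [x t]; rewrite /rV_uncons mxE unlift_none/=; congr pair.
by apply/rowP => j; rewrite !mxE liftK.
Qed.

Lemma rV_unconsK (R : realType) n : cancel (@rV_uncons R n) (@rV_cons R n).
Proof.
move=> x; apply/rowP => i; rewrite mxE /rV_uncons/=.
by case: unliftP => [j|] ->/=; rewrite ?mxE.
Qed.

Lemma measurable_rV_uncons (R : realType) n :
  measurable_fun [set: 'rV[R]_n.+1] (@rV_uncons R n).
Proof.
apply/measurable_fun_pair; last exact: measurable_coord.
apply: measurable_fun_rVP => j.
by under eq_fun do rewrite mxE; exact: measurable_coord.
Qed.

Section lebesgue_rV_step.
Local Open Scope ereal_scope.
Context {R : realType} {n : nat}.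
Variable mu : {sigma_finite_measure set 'rV[R]_n -> \bar R}.

Definition lebesgue_rV_step : set 'rV[R]_n.+1 -> \bar R :=
  pushforward (mu \x (@lebesgue_measure R)) (@rV_cons R n).

HB.instance Definition _ := Measure.copy lebesgue_rV_step
  (measure_function_pushforward__canonical__measure_function_Measure
    (mu \x (@lebesgue_measure R)) (@measurable_rV_cons R n)).

Let lebesgue_rV_step_sigma_finite : sigma_finite setT lebesgue_rV_step.
Proof.
have /sigma_finiteP[F [TF ndF Foo]] := sigma_finiteT mu.
have /sigma_finiteP[G [TG ndG Goo]] := sigma_finiteT (@lebesgue_measure R).
exists (fun k => @rV_uncons R n @^-1` (F k `*` G k)).
  apply/esym/seteqP; split => // x _.
  have [i _ Fi] : (\bigcup_i F i) (rV_uncons x).1 by rewrite -TF.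
  have [j _ Gj] : (\bigcup_i G i) (rV_uncons x).2 by rewrite -TG.
  exists (maxn i j) => //; split.
  - by move: Fi; apply/subsetPset/ndF/leq_maxl.
  - by move: Gj; apply/subsetPset/ndG/leq_maxr.
move=> k; have [mF Fk] := Foo k; have [mG Gk] := Goo k; split.
  rewrite -[X in measurable X]setTI; apply: measurable_rV_uncons => //.
  exact: measurableX.
rewrite /lebesgue_rV_step /pushforward -comp_preimage.
rewrite (_ : _ \o _ = id) ?preimage_id; last first.
  by apply/funext => p /=; rewrite rV_consK.
by rewrite product_measure1E// lte_mul_pinfty// ge0_fin_numE.
Qed.

HB.instance Definition _ := Measure_isSigmaFinite.Build _ _ _
  lebesgue_rV_step lebesgue_rV_step_sigma_finite.

End lebesgue_rV_step.

(* The n-fold product of the one-dimensional Lebesgue measure, characterized by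
   lebesgue_rV_box below. *)
Fixpoint lebesgue_rV (R : realType) (n : nat) :
    {sigma_finite_measure set 'rV[R]_n -> \bar R} :=
  match n with
  | 0 => \d_(0 : 'rV[R]_0)
  | m.+1 => lebesgue_rV_step (lebesgue_rV R m)
  end.

Lemma lebesgue_rV_box (R : realType) (n : nat)
    (A : 'I_n -> set (measurableTypeR R)) :
  (forall i, measurable (A i)) ->
  lebesgue_rV R n [set x | forall i, A i (x ord0 i)] =
  (\prod_(i < n) lebesgue_measure (A i))%E.
Proof.
elim: n A => [|n IH] A mA /=.
  by rewrite big_ord0 /= diracE mem_set//= => -[].
rewrite big_ord_recl/= /lebesgue_rV_step /pushforward.
pose B := [set x : 'rV[R]_n | forall i, A (lift ord0 i) (x ord0 i)].
rewrite (_ : _ @^-1` _ = B `*` A ord0); last first.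
  apply/seteqP; split => -[x t] /=.
    move=> h; split => /=; last by have := h ord0; rewrite mxE unlift_none.
    by move=> i; have := h (lift ord0 i); rewrite mxE liftK.
  move=> [/= hx ht] i; rewrite mxE.
  by case: unliftP => [j|] ->/=; [exact: hx|exact: ht].
rewrite product_measure1E//; last first.
  have -> : B = \bigcap_(i in [set: 'I_n])
      (fun x : 'rV[R]_n => x ord0 i) @^-1` A (lift ord0 i).
    by apply/seteqP; split => x /= h i; [move=> _|]; exact: h.
  apply: fin_bigcap_measurable => // i _.
  rewrite -[X in measurable X]setTI.
  by apply: (measurable_coord i) => //; exact: mA.
rewrite [LHS]muleC; congr (_ * _)%E.
by apply: (IH (fun i => A (lift ord0 i))) => i; exact: mA.
Qed.

Section sobolev.
Context {R : realType} {d : nat}.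
Implicit Types (B : set 'rV[R]_d) (u phi : 'rV[R]_d -> R)
  (Du : 'rV[R]_d -> 'rV[R]_d).

(* `|x| on 'rV[R]_d is the sup norm, hence a separate Euclidean norm. *)
Definition enorm (x : 'rV[R]_d) : R := Num.sqrt (\sum_(i < d) x ord0 i ^+ 2).

Definition unit_ball : set 'rV[R]_d := [set x | enorm x < 1].

Definition partial (i : 'I_d) phi : 'rV[R]_d -> R :=
  'D_(delta_mx ord0 i) phi.

Definition smooth phi := forall s : seq 'I_d,
  let psi := foldr partial phi s in
  continuous psi /\ forall i x, derivable psi x (delta_mx ord0 i).

Definition test_function B phi :=
  let supp := closure [set x | phi x != 0] in
  [/\ smooth phi, compact supp & supp `<=` B].

(* Functions on B are represented by total functions whose values outside B
   are irrelevant: only their extension by zero matters. *)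
Definition L2norm B u : \bar R :=
  Lnorm (lebesgue_rV R d) 2%:E (EFin \o (u \_ B)).

Definition L2 B u := (u \_ B) \in Lfun (lebesgue_rV R d) 2%:E.

Definition weak_gradient B u Du := forall (i : 'I_d) phi, test_function B phi ->
  \int[lebesgue_rV R d]_(x in B) (u x * partial i phi x) =
  - \int[lebesgue_rV R d]_(x in B) (Du x ord0 i * phi x).

(* The integrals in weak_gradient are meaningful for u, Du in L^2(B) only, so
   weak_gradient is always used together with these conditions. *)
Definition L2_weak_gradient B u Du :=
  (forall i, L2 B (fun x => Du x ord0 i)) /\ weak_gradient B u Du.

Definition H1 B : set ('rV[R]_d -> R) :=
  [set u | L2 B u /\ exists Du, L2_weak_gradient B u Du].

End sobolev.

Arguments unit_ball {R} d.

(* Main.v *)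
Require Import Defs.
From mathcomp Require Import all_boot all_order all_algebra.
From mathcomp Require Import all_classical all_reals all_analysis.
From mathcomp Require Import measurable_realfun ring lra.
Import Order.TTheory GRing.Theory Num.Theory.
Import numFieldNormedType.Exports.

Local Open Scope classical_set_scope.
Local Open Scope ring_scope.

Set Implicit Arguments.
Unset Strict Implicit.
Unset Printing Implicit Defensive.

(** The inequality is obtained by comparing [u] at the two ends of a segment,
    without ever regularizing [u].  Extend [u] and its weak gradient by zero
    outside the ball, and fix a vector h.

    Testing the weak gradient against the translates psi(. - t h) of a bump
    psi and integrating in t over [0, s] (FTC for psi, Fubini, translation
    invariance of the measure) gives
      integral of psi(x) [u(x + s h) - u(x) - int_0^s (Du . h)(x + t h) dt] = 0,
    which is [weak_line].  As there are enough bumps, the bracket vanishes for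
    almost every x such that x and x + h lie in the ball ([line_identity]); the
    ball being convex, the whole segment then lies in it, so that all the
    translated bumps are admissible test functions.

    By Fubini, for almost every such x the identity holds for almost every s:
    along the segment, [u] coincides almost everywhere with a continuous
    function whose increments are integrals of Du . h.  If u(x) <= a and
    b <= u(x + h), this function has to cross ]a, b[, and during the crossing
    it increases by b - a, hence
      b - a <= int_0^1 1_{a < u < b} |Du . h| (x + t h) dt
    ([crossing_le], [ae_crossing]).  This replaces the chain rule for
    truncations of Sobolev functions.  Integrating in x and using translation
    invariance again,
      (b - a) |{x : u(x) <= a, u(x + h) >= b}| <= int_{a < u < b} |Du . h|
    ([translate_bound]).  Finally, two points of the unit ball differ by a
    vector h in [-2, 2]^d; integrating over this cube turns the left-hand side
    into (b - a) |{u <= a}| |{u >= b}| and keeps the right-hand side below a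
    dimensional constant times int_{a < u < b} |Du| ([low_high_bound]), which
    the Cauchy-Schwarz inequality bounds as required ([band_hoelder]). *)

(** * Translation invariance of the Lebesgue measure *)

Section translation.
Context {R : realType}.
Local Open Scope ereal_scope.

Lemma lebesgue_measure_shift (c : R) (A : set (measurableTypeR R)) :
  measurable A ->
  pushforward lebesgue_measure (+%R^~ c : R -> measurableTypeR R) A =
  lebesgue_measure A.
Proof.
have mc : measurable_fun [set: measurableTypeR R] (+%R^~ c : R -> measurableTypeR R).
  by apply: measurable_funD => //; exact: measurable_id.
pose nu := measure_function_pushforward__canonical__measure_function_Measure
    (@lebesgue_measure R) mc.
move=> mA; apply/esym/(@lebesgue_measure_unique _ nu) => // _ [[a b] _ <-].
rewrite /nu /= /pushforward.
rewrite (_ : _ @^-1` _ = `]a - c, b - c]%classic)%R; last first.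
  by apply/seteqP; split => x /=; rewrite !in_itv/= ltrBlDr lerBrDr.
by rewrite !lebesgue_measure_itv/= !lte_fin ltrD2r -!EFinB opprB addrA subrK.
Qed.

Lemma measurable_rV_shift n (h : 'rV[R]_n) :
  measurable_fun [set: 'rV[R]_n] (fun x : 'rV[R]_n => (x + h)%R).
Proof.
apply: measurable_fun_rVP => i; under eq_fun do rewrite mxE.
by apply: measurable_funD => //; exact: measurable_coord.
Qed.

(** By induction on the dimension: a section of the translated set is a
    translate of a section, so the last coordinate is handled by the
    one-dimensional case and the others by the induction hypothesis. *)
Lemma lebesgue_rV_shift n (h : 'rV[R]_n) (A : set 'rV[R]_n) : measurable A ->
  pushforward (lebesgue_rV R n) (fun x => x + h)%R A = lebesgue_rV R n A.
Proof.
elim: n h A => [|n IH] h A mA.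
  rewrite /pushforward; congr (_ _); apply/seteqP; split => x /=;
  by rewrite (_ : x + h = x)%R //; apply/rowP => -[].
rewrite /pushforward /= /lebesgue_rV_step /pushforward.
pose h' := (rV_uncons h).1; pose c := (rV_uncons h).2.
have consD p : (rV_cons p + h = rV_cons (p.1 + h', p.2 + c))%R.
  apply/rowP => i; rewrite !mxE /=.
  by case: unliftP => [j|] -> /=; rewrite ?mxE.
set A' := rV_cons (n := n) @^-1` A.
have mA' : measurable A'.
  rewrite -[A']setTI; exact: measurable_rV_cons.
rewrite /product_measure1.
transitivity (\int[lebesgue_rV R n]_x (lebesgue_measure (xsection A' (x + h')%R))).
  apply: eq_integral => x _ /=.
  rewrite -(@lebesgue_measure_shift c (xsection A' (x + h')%R)); last first.
    exact: measurable_xsection.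
  rewrite /pushforward; congr (lebesgue_measure _).
  apply/seteqP; split => t; rewrite /xsection /= !inE /= /A' /=;
  by rewrite consD.
have mh := @measurable_rV_shift n h'.
pose nu := measure_function_pushforward__canonical__measure_function_Measure
    (lebesgue_rV R n) mh.
rewrite -[LHS](@ge0_integral_pushforward _ _ _ _ _ _ mh (lebesgue_rV R n) setT
  (fun x => lebesgue_measure (xsection A' x))) //.
- apply: eq_measure_integral => B mB _; exact: IH.
- exact: measurable_fun_xsection.
Qed.

Lemma ge0_integral_rV_shift n (h : 'rV[R]_n) (f : 'rV[R]_n -> \bar R) :
  measurable_fun setT f -> (forall x, 0 <= f x) ->
  \int[lebesgue_rV R n]_x f (x + h)%R = \int[lebesgue_rV R n]_x f x.
Proof.
move=> mf f0; have mh := @measurable_rV_shift n h.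
rewrite -[LHS](@ge0_integral_pushforward _ _ _ _ _ _ mh (lebesgue_rV R n) setT f) //.
by apply: eq_measure_integral => B mB _; exact: lebesgue_rV_shift.
Qed.

Lemma integral_rV_shift n (h : 'rV[R]_n) (f : 'rV[R]_n -> \bar R) :
  measurable_fun setT f ->
  \int[lebesgue_rV R n]_x f (x + h)%R = \int[lebesgue_rV R n]_x f x.
Proof.
move=> mf; rewrite integralE [RHS]integralE.
rewrite -(ge0_integral_rV_shift h (measurable_funepos mf))//.
rewrite -(ge0_integral_rV_shift h (measurable_funeneg mf))//.
by congr (_ - _); apply: eq_integral => x _; rewrite ?funeposE ?funenegE.
Qed.

Lemma integrable_rV_shift n (h : 'rV[R]_n) (f : 'rV[R]_n -> \bar R) :
  (lebesgue_rV R n).-integrable setT f ->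
  (lebesgue_rV R n).-integrable setT (fun x => f (x + h)%R).
Proof.
move=> /integrableP[mf foo]; apply/integrableP; split.
  by apply: (measurableT_comp mf); exact: measurable_rV_shift.
rewrite (@ge0_integral_rV_shift n h (abse \o f)) //.
  exact: measurableT_comp.
by move=> x /=.
Qed.

End translation.

(** * The flat function and its derivatives *)

Section flat.
Context {R : realType}.
Implicit Types (k : nat) (x y : R).

(** The polynomials P_k such that the k-th derivative of exp(- 1 / x) on
    x > 0 is P_k(1 / x) exp(- 1 / x). *)
Fixpoint flat_poly (k : nat) : {poly R} :=
  if k is k'.+1 then 'X^2 * (flat_poly k' - (flat_poly k')^`()) else 1.

(** The k-th derivative of the smooth function that is exp(- 1 / x) for
    x > 0 and 0 for x <= 0 ([is_derive_flat]). *)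
Definition flat (k : nat) (x : R) : R :=
  if 0 < x then (flat_poly k).[x^-1] * expR (- x^-1) else 0.

Lemma expr_expRN_le n y : 0 <= y -> y ^+ n * expR (- y) <= n`!%:R.
Proof.
move=> y0; case: n => [|n].
  by rewrite expr0 mul1r -expR0 ler_expR oppr_le0.
rewrite expRN ler_pdivrMr ?expR_gt0// mulrC -ler_pdivrMr ?ltr0n ?fact_gt0//.
by apply: le_trans (expR_ge1Dxn n y0); rewrite lerDr.
Qed.

Lemma poly_expRN_bounded (p : {poly R}) :
  exists2 C, 0 <= C & forall y, 0 <= y -> `|p.[y]| * expR (- y) <= C.
Proof.
exists (\sum_(i < size p) `|p`_i| * i`!%:R).
  by apply: sumr_ge0 => i _; rewrite mulr_ge0.
move=> y y0; rewrite horner_coef.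
apply: (@le_trans _ _ ((\sum_(i < size p) `|p`_i| * y ^+ i) * expR (- y))).
  rewrite ler_wpM2r ?expR_ge0//; apply: le_trans (ler_norm_sum _ _ _) _.
  by apply: ler_sum => i _; rewrite normrM (ger0_norm (exprn_ge0 i y0)).
rewrite mulr_suml; apply: ler_sum => i _.
by rewrite -mulrA ler_wpM2l// expr_expRN_le.
Qed.

(** Quadratic decay at 0 is what makes each [flat k] differentiable there,
    with derivative 0.  The exponential decay of exp(- y) beats the polynomial
    y ^ 2 * P_k(y), where y = 1 / x. *)
Lemma flat_le_sqr k : exists2 C, 0 <= C & forall x, `|flat k x| <= C * x ^+ 2.
Proof.
have [C C0 hC] := poly_expRN_bounded ('X^2 * flat_poly k).
exists C => // x; rewrite /flat; case: ifPn => x0; last first.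
  by rewrite normr0 mulr_ge0// sqr_ge0.
have := hC x^-1; rewrite invr_ge0 ltW// => /(_ isT).
rewrite hornerM hornerXn normrM -mulrA exprVn.
rewrite (ger0_norm (x := (x ^+ 2)^-1)) ?invr_ge0 ?sqr_ge0//.
rewrite mulrC ler_pdivrMr ?exprn_gt0// => h.
by rewrite normrM (ger0_norm (expR_ge0 _)).
Qed.

Lemma is_derive_flat k x : is_derive x 1 (flat k) (flat k.+1 x).
Proof.
have [x0|x0|->] := ltgtP x 0.
- rewrite {2}/flat ltNge (ltW x0)/=.
  apply: (@near_eq_is_derive _ _ _ (cst 0)).
  by near=> z; rewrite /= /flat ltNge ltW//=; near: z; exact: lt_nbhsl.
- rewrite {2}/flat x0.
  apply: (@near_eq_is_derive _ _ _
      ((horner (flat_poly k) \o GRing.inv) * (expR \o (fun z => - z^-1)))).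
    by near=> z; rewrite /= /flat ifT//; near: z; exact: lt_nbhsr.
  have x1 : x != 0 by rewrite gt_eqF.
  have dV : is_derive x 1 (fun z => z^-1) (- x ^- 2 *: 1) by exact: is_deriveV.
  have dP := is_derive1_comp (is_derive_poly (flat_poly k) x^-1) dV.
  have dN : is_derive x 1 (fun z => - z^-1) (- (- x ^- 2 *: 1)).
    exact: is_deriveN.
  have dE := @is_derive1_comp _ expR (fun z => - z^-1) x _ _ (is_derive_expR _) dN.
  apply: is_derive_eq.
  rewrite /= !hornerE !scaler1 /GRing.scale/= -exprVn.
  by ring.
- rewrite {2}/flat ltxx.
  (* At 0, the difference quotient is at most C |h| in absolute value. *)
  have [C C0 hC] := flat_le_sqr k.
  have H : h^-1 *: (flat k (h *: 1 + 0) - flat k 0) @[h --> 0^'] --> (0 : R).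
    rewrite [flat k 0]/flat ltxx.
    apply/cvgrPdist_le => e e0; near=> h.
    have h0 : h != 0 by near: h; exact: nbhs_dnbhs_neq.
    rewrite sub0r normrN subr0 /GRing.scale/= mulr1 addr0 normrM normfV.
    rewrite ler_pdivrMl ?normr_gt0//; apply: le_trans (hC h) _.
    rewrite -(ger0_norm (sqr_ge0 h)) normrX expr2 mulrCA ler_wpM2l//.
    apply: (@le_trans _ _ ((C + 1) * `|h|)); first by rewrite ler_wpM2r// lerDl.
    rewrite -ler_pdivlMl ?ltr_wpDl//; near: h; apply: dnbhs0_le.
    by rewrite mulr_gt0// invr_gt0 ltr_wpDl.
  split; first by apply/cvg_ex; exists 0.
  exact: cvg_lim.
Unshelve. all: by end_near. Qed.

End flat.

Section flat_basic.
Context {R : realType}.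
Implicit Types (k : nat) (x y : R).

Lemma differentiable_flat k x : differentiable (@flat R k) x.
Proof. by apply/derivable1_diffP; case: (is_derive_flat k x). Qed.

Lemma measurable_flat k : measurable_fun setT (@flat R k).
Proof.
by apply: continuous_measurable_fun => x; exact/differentiable_continuous/differentiable_flat.
Qed.

Lemma flat0E x : flat 0 x = if 0 < x then expR (- x^-1) else 0.
Proof. by rewrite /flat hornerC mul1r. Qed.

Lemma flat0_ge0 x : 0 <= flat 0 x.
Proof. by rewrite flat0E; case: ifP => // _; exact: expR_ge0. Qed.

Lemma flat0_le1 x : flat 0 x <= 1.
Proof.
rewrite flat0E; case: ifP => // x0.
by rewrite -expR0 ler_expR oppr_le0 invr_ge0 ltW.
Qed.

Lemma flat0_neq0 x : (flat 0 x != 0) = (0 < x).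
Proof. by rewrite flat0E; case: ifP => _; rewrite ?eqxx// expR_eq0. Qed.

(** In the limit, products of such factors become indicators of products of
    half-lines ([ray_bump_cvg]). *)
Lemma flat0_cvg x : flat 0 (n.+1%:R * x : R) @[n --> \oo] --> ((0 < x)%R%:R : R).
Proof.
case: ltP => x0; last first.
  rewrite (_ : (fun _ => _) = cst 0); first exact: cvg_cst.
  apply/funext => n; rewrite flat0E ifF//; apply/negbTE; rewrite -leNgt.
  by rewrite mulr_ge0_le0.
rewrite (_ : (fun _ => _) = fun n => expR (harmonic n * - x^-1)); last first.
  apply/funext => n; rewrite flat0E mulr_gt0//; congr expR.
  by rewrite invfM mulrN.
rewrite -[X in _ --> X]expR0; apply: continuous_cvg; first exact: continuous_expR.
rewrite -[X in _ --> X](mul0r (- x^-1)); apply: cvgMr_tmp; exact: cvg_harmonic.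
Qed.

End flat_basic.

(** * Smooth expressions *)

Section smooth_expr.
Context {R : realType} {d : nat}.
Implicit Types (f g p : 'rV[R]_d -> R) (x h v : 'rV[R]_d).

(** A class of functions stable under directional derivatives and
    translations.  Since every member is differentiable, every member is
    infinitely differentiable; membership is proved by syntactic inspection,
    which avoids computing higher derivatives of products and compositions. *)
Inductive smooth_expr : ('rV[R]_d -> R) -> Prop :=
| smooth_expr_coord i : smooth_expr (fun x => x ord0 i)
| smooth_expr_cst c : smooth_expr (cst c)
| smooth_exprD f g : smooth_expr f -> smooth_expr g ->
    smooth_expr (fun x => f x + g x)
| smooth_exprM f g : smooth_expr f -> smooth_expr g ->
    smooth_expr (fun x => f x * g x)
| smooth_expr_flat k p : smooth_expr p -> smooth_expr (fun x => flat k (p x)).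

Lemma smooth_expr_differentiable f x : smooth_expr f -> differentiable f x.
Proof.
elim=> {f} [i|c|f g _ df _ dg|f g _ df _ dg|k p _ dp].
- exact: differentiable_coord.
- exact: differentiable_cst.
- exact: differentiableD.
- exact: differentiableM.
- by apply: (@differentiable_comp _ _ _ _ p (flat k)) => //; exact: differentiable_flat.
Qed.

Lemma smooth_expr_derive f v : smooth_expr f -> smooth_expr ('D_v f).
Proof.
have dS g x : smooth_expr g -> derivable g x v.
  by move=> ?; exact/diff_derivable/smooth_expr_differentiable.
elim=> {f} [i|c|f g sf Df sg Dg|f g sf Df sg Dg|k p sp Dp].
- rewrite (_ : 'D_v _ = cst (v ord0 i)); first exact: smooth_expr_cst.
  apply/funext => x; apply: cvg_lim => //.
  apply: cvg_near_cst; near=> t.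
  have t0 : t != 0 by near: t; exact: nbhs_dnbhs_neq.
  by rewrite /= !mxE addrK /GRing.scale/= mulKf.
- rewrite (_ : 'D_v _ = cst 0); first exact: smooth_expr_cst.
  by apply/funext => x; rewrite derive_cst.
- rewrite (_ : 'D_v _ = fun x => 'D_v f x + 'D_v g x); first exact: smooth_exprD.
  by apply/funext => x; rewrite [LHS](deriveD (dS _ x sf) (dS _ x sg)).
- rewrite (_ : 'D_v _ = fun x => f x * 'D_v g x + g x * 'D_v f x).
    by apply: smooth_exprD; apply: smooth_exprM.
  by apply/funext => x; rewrite [LHS](deriveM (dS _ x sf) (dS _ x sg)).
- rewrite (_ : 'D_v _ = fun x => flat k.+1 (p x) * 'D_v p x).
    by apply: smooth_exprM => //; exact: smooth_expr_flat.
  apply/funext => x.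
  have dp := smooth_expr_differentiable x sp.
  have df := differentiable_flat k (p x).
  have dfp : differentiable (flat k \o p) x by exact: differentiable_comp.
  rewrite (deriveE v dfp) diff_comp//= -(deriveE v dp).
  have [dfk <-] := is_derive_flat k (p x).
  by rewrite -derive1E (deriv1E dfk) /GRing.scale/= mulrC.
Unshelve. all: by end_near. Qed.

Lemma smooth_expr_smooth f : smooth_expr f -> smooth f.
Proof.
move=> sf s; set psi := foldr _ _ _.
have spsi : smooth_expr psi.
  by rewrite /psi; elim: s {psi} => //= i s IH; exact: smooth_expr_derive.
split=> [x|i x]; first exact/differentiable_continuous/smooth_expr_differentiable.
exact/diff_derivable/smooth_expr_differentiable.
Qed.

(** Measurability is proved along the construction because the
    sigma-algebra on row vectors is generated by the coordinates, not by the
    open sets. *)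
Lemma smooth_expr_measurable f : smooth_expr f -> measurable_fun setT f.
Proof.
elim=> {f} [i|c|f g _ mf _ mg|f g _ mf _ mg|k p _ mp].
- exact: measurable_coord.
- exact: measurable_cst.
- exact: measurable_funD.
- exact: measurable_funM.
- by apply: measurableT_comp mp; exact: measurable_flat.
Qed.

Lemma smooth_expr_shift f h : smooth_expr f -> smooth_expr (fun x => f (x + h)).
Proof.
elim=> {f} [i|c|f g _ sf _ sg|f g _ sf _ sg|k p _ sp].
- under eq_fun do rewrite mxE.
  by apply: smooth_exprD; [exact: smooth_expr_coord|exact: smooth_expr_cst].
- exact: smooth_expr_cst.
- exact: smooth_exprD.
- exact: smooth_exprM.
- exact: smooth_expr_flat.
Qed.

Lemma smooth_expr_sum (I : Type) (r : seq I) (F : I -> 'rV[R]_d -> R) :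
  (forall i, smooth_expr (F i)) -> smooth_expr (fun x => \sum_(i <- r) F i x).
Proof.
move=> sF; elim: r => [|i r IH].
  by under eq_fun do rewrite big_nil; exact: smooth_expr_cst.
by under eq_fun do rewrite big_cons; exact: smooth_exprD.
Qed.

Lemma smooth_expr_prod (I : Type) (r : seq I) (F : I -> 'rV[R]_d -> R) :
  (forall i, smooth_expr (F i)) -> smooth_expr (fun x => \prod_(i <- r) F i x).
Proof.
move=> sF; elim: r => [|i r IH].
  by under eq_fun do rewrite big_nil; exact: smooth_expr_cst.
by under eq_fun do rewrite big_cons; exact: smooth_exprM.
Qed.

Lemma deriveE_partial f v x : differentiable f x ->
  'D_v f x = \sum_(i < d) v ord0 i * partial i f x.
Proof.
move=> df; rewrite deriveE// [in LHS](row_sum_delta v) linear_sum.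
by apply: eq_bigr => i _; rewrite linearZ /partial deriveE.
Qed.

Lemma is_derive_line f v x (t : R) : smooth_expr f ->
  is_derive t 1 (fun t => f (x - t *: v)) (- 'D_v f (x - t *: v)).
Proof.
move=> sf.
have -> : (fun t => f (x - t *: v)) = f \o (fun t => x - t *: v) by [].
have dl : is_diff t (fun t => x - t *: v) (fun t => - (t *: v)).
  by apply: is_diff_eq; apply/funext => s /=; rewrite sub0r.
have df := smooth_expr_differentiable (x - t *: v) sf.
have dfl : differentiable (f \o (fun t => x - t *: v)) t by exact: differentiable_comp.
split; first exact/derivable1_diffP.
rewrite deriveE// diff_comp//= diff_val scale1r linearN.
by rewrite -deriveE.
Qed.

End smooth_expr.

(** * Bump functions inside the unit ball *)

Section bump.
Context {R : realType} {d : nat}.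
Implicit Types (f g p : 'rV[R]_d -> R) (x h v q : 'rV[R]_d).

Definition sqnorm x : R := \sum_(i < d) x ord0 i ^+ 2.

Lemma unit_ballE x : unit_ball d x <-> sqnorm x < 1.
Proof.
rewrite /unit_ball /enorm /= -/(sqnorm x) -{1}sqrtr1 ltr_sqrt//.
Qed.

Lemma smooth_expr_sqnorm : smooth_expr sqnorm.
Proof.
by apply: smooth_expr_sum => i; apply: smooth_exprM; exact: smooth_expr_coord.
Qed.

(** Coordinatewise, the gap is t (1 - t) h_i ^ 2. *)
Lemma sqnorm_convex x h (t : R) : 0 <= t <= 1 ->
  sqnorm (x + t *: h) <= (1 - t) * sqnorm x + t * sqnorm (x + h).
Proof.
move=> /andP[t0 t1]; rewrite /sqnorm !mulr_sumr -big_split/=.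
apply: ler_sum => i _; rewrite !mxE; set a := x _ _; set b := h _ _.
rewrite -subr_ge0 (_ : _ - _ = t * (1 - t) * b ^+ 2); last by ring.
by apply: mulr_ge0; [apply: mulr_ge0; rewrite ?subr_ge0|exact: sqr_ge0].
Qed.

Lemma sqnorm_segment_le x h (c t : R) : 0 <= t <= 1 ->
  sqnorm x <= c -> sqnorm (x + h) <= c -> sqnorm (x + t *: h) <= c.
Proof.
move=> t01 xc xhc; apply: (le_trans (sqnorm_convex x h t01)).
move: t01 => /andP[t0 t1]; rewrite [leRHS](_ : _ = (1 - t) * c + t * c); last by ring.
by rewrite lerD// ler_wpM2l// subr_ge0.
Qed.

Lemma continuous_sqnorm : continuous sqnorm.
Proof.
move=> x; exact/differentiable_continuous/smooth_expr_differentiable/smooth_expr_sqnorm.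
Qed.

Lemma closed_sqnorm_le (c : R) : closed [set x | sqnorm x <= c].
Proof.
rewrite (_ : [set x | _] = sqnorm @^-1` [set y | y <= c])//.
by apply: closed_comp; [move=> x _; exact: continuous_sqnorm|exact: closed_le].
Qed.

Lemma compact_sqnorm_le (c : R) : compact [set x | sqnorm x <= c].
Proof.
have box : compact [set x : 'rV[R]_d | forall i, `[- (c + 1), c + 1]%classic (x ord0 i)].
  by apply: (@rV_compact _ _ (fun=> `[- (c + 1), c + 1]%classic)) => _; exact: segment_compact.
apply: subclosed_compact box _; first exact: closed_sqnorm_le.
move=> x /= xc i; rewrite /= in_itv/=.
have : x ord0 i ^+ 2 <= c.
  apply: le_trans xc; rewrite /sqnorm (bigD1 i)//= lerDl.
  by apply: sumr_ge0 => j _; exact: sqr_ge0.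
by move: (x ord0 i) => y ?; apply/andP; split; nra.
Qed.

Lemma test_function_bump f (c : R) : c < 1 -> smooth_expr f ->
  (forall x, f x != 0 -> sqnorm x <= c) -> test_function (unit_ball d) f.
Proof.
move=> c1 sf fc.
have supp_c : closure [set x | f x != 0] `<=` [set x | sqnorm x <= c].
  rewrite closureE; apply: smallest_sub; [exact: closed_sqnorm_le|exact: fc].
split; first exact: smooth_expr_smooth.
- apply: subclosed_compact supp_c; [exact: closed_closure|exact: compact_sqnorm_le].
- by move=> x /supp_c /= xc; apply/unit_ballE; exact: le_lt_trans c1.
Qed.

Lemma bump_bounded f (c : R) : smooth_expr f ->
  (forall x, f x != 0 -> sqnorm x <= c) -> exists M, forall x, `|f x| <= M.
Proof.
move=> sf fc.
have cf : continuous f.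
  by move=> x; exact/differentiable_continuous/smooth_expr_differentiable.
have /compact_bounded[M [Mreal hM]] :
    compact (f @` [set x | sqnorm x <= c]).
  by apply: continuous_compact; [exact: continuous_subspaceT|exact: compact_sqnorm_le].
exists (Num.max 0 (M + 1)) => x; have [->|fx0] := eqVneq (f x) 0.
  by rewrite normr0 le_max lexx.
rewrite le_max; apply/orP; right; apply: (hM (M + 1)); first by rewrite ltrDl.
by exists x => //=; exact: fc.
Qed.

Lemma derive_bump f (c : R) v : (forall x, f x != 0 -> sqnorm x <= c) ->
  forall x, 'D_v f x != 0 -> sqnorm x <= c.
Proof.
move=> fc x; apply: contraNle => cx.
rewrite (@near_eq_derive _ _ _ f (cst 0)) ?derive_cst//.
have : open [set y | c < sqnorm y].
  rewrite (_ : [set y | _] = ~` [set y | sqnorm y <= c]).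
    exact/closed_openC/closed_sqnorm_le.
  by apply/seteqP; split => y /=; rewrite ltNge => /negP.
rewrite openE => /(_ x cx); apply: filterS => y /= cy.
by apply/eqP; apply: contraTT cy => /fc; rewrite -leNgt.
Qed.

(** Positive exactly where x and x + h both lie in the ball of squared
    radius 1 - 1 / (m + 1).  As m varies these sets exhaust the points for
    which the two ends of the segment lie in the unit ball. *)
Definition inner_bump m h x : R :=
  flat 0 (1 - m.+1%:R^-1 - sqnorm x) * flat 0 (1 - m.+1%:R^-1 - sqnorm (x + h)).

(** A smooth approximation, as n grows, of the indicator of the product of
    the half-lines ]q_i, +oo[. *)
Definition ray_bump n q x : R := \prod_(i < d) flat 0 (n.+1%:R * (x ord0 i - q ord0 i)).

Lemma smooth_expr_inner_bump m h : smooth_expr (inner_bump m h).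
Proof.
have sB g : smooth_expr g -> smooth_expr (fun x => 1 - m.+1%:R^-1 - g x).
  move=> sg; apply: smooth_exprD; first exact: smooth_expr_cst.
  under eq_fun do rewrite -mulN1r.
  by apply: smooth_exprM => //; exact: smooth_expr_cst.
apply: smooth_exprM; apply: smooth_expr_flat; apply: sB.
  exact: smooth_expr_sqnorm.
exact/smooth_expr_shift/smooth_expr_sqnorm.
Qed.

Lemma smooth_expr_ray_bump n q : smooth_expr (ray_bump n q).
Proof.
apply: smooth_expr_prod => i; apply: smooth_expr_flat.
apply: smooth_exprM; first exact: smooth_expr_cst.
by apply: smooth_exprD; [exact: smooth_expr_coord|exact: smooth_expr_cst].
Qed.

Lemma inner_bump_neq0 m h x : inner_bump m h x != 0 ->
  sqnorm x <= 1 - m.+1%:R^-1 /\ sqnorm (x + h) <= 1 - m.+1%:R^-1.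
Proof.
rewrite mulf_eq0 negb_or !flat0_neq0 !subr_gt0 => /andP[h1 h2].
by split; exact: ltW.
Qed.

Lemma inner_bump_exists h x : unit_ball d x -> unit_ball d (x + h) ->
  exists m, inner_bump m h x != 0.
Proof.
move=> /unit_ballE x1 /unit_ballE xh1.
have : 0 < 1 - Num.max (sqnorm x) (sqnorm (x + h)) by rewrite subr_gt0 gt_max x1.
move=> /ltr_add_invr[m]; rewrite add0r => hm; exists m.
rewrite mulf_neq0// flat0_neq0 subr_gt0 ltrBrDr -ltrBrDl;
  apply: (lt_le_trans hm); rewrite lerB// le_max lexx ?orbT//.
Qed.

Lemma inner_bump_bound m h x : 0 <= inner_bump m h x <= 1.
Proof. by rewrite mulr_ge0 ?flat0_ge0//= mulr_ile1 ?flat0_ge0 ?flat0_le1. Qed.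

Lemma ray_bump_bound n q x : 0 <= ray_bump n q x <= 1.
Proof.
rewrite prodr_ge0/=; last by move=> i _; exact: flat0_ge0.
by apply: prodr_ile1 => i _; rewrite flat0_ge0 flat0_le1.
Qed.

Definition ray q : set 'rV[R]_d := [set x | forall i, q ord0 i < x ord0 i].

Lemma ray_bump_cvg q x : ray_bump n q x @[n --> \oo] --> (\1_(ray q) x : R).
Proof.
have -> : \1_(ray q) x = \prod_(i < d) (0 < x ord0 i - q ord0 i)%R%:R :> R.
  rewrite indicE; have [xq|xq] := boolP (x \in ray q).
    move/set_mem : xq => xq; rewrite big1// => i _.
    by rewrite subr_gt0 xq.
  have [i qi] : exists i, ~ (q ord0 i < x ord0 i).
    by apply/existsNP => h; move/negP: xq; apply; exact/mem_set.
  rewrite (bigD1 i)//= subr_gt0; move/negP/negbTE: qi => ->.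
  by rewrite mul0r.
apply: cvg_big => [|i _]; [exact: mul_continuous|exact: flat0_cvg].
Qed.

End bump.

(** * Functions with vanishing integrals against bumps *)

Section vanishing_integrals.
Context {R : realType}.
Local Open Scope ereal_scope.

Lemma integral_bounded_weights_cvg d' (T : measurableType d')
    (mu : {measure set T -> \bar R}) (w : T -> R) (h_ : nat -> T -> R) (h : T -> R) :
  mu.-integrable setT (EFin \o w) ->
  (forall n, measurable_fun setT (h_ n)) -> measurable_fun setT h ->
  (forall n x, (`|h_ n x| <= 1)%R) ->
  (forall x, h_ n x @[n --> \oo] --> h x) ->
  \int[mu]_x (w x * h_ n x)%:E @[n --> \oo] --> \int[mu]_x (w x * h x)%:E.
Proof.
move=> iw mh_ mh h1 hh.
have mw : measurable_fun setT w by apply/measurable_EFinP; exact: measurable_int iw.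
have [//|||||_ _ //] := @dominated_convergence _ _ _ mu setT measurableT
  (fun n x => (w x * h_ n x)%:E) (fun x => (w x * h x)%:E) (abse \o (EFin \o w)).
- by move=> n; apply/measurable_EFinP; exact: measurable_funM.
- by apply/measurable_EFinP; exact: measurable_funM.
- apply: aeW => x _; apply: cvg_EFin; first exact: nearW.
  by apply: cvgM; [exact: cvg_cst|exact: hh].
- exact: integrable_abse.
- apply: aeW => x n _ /=; rewrite lee_fin normrM.
  by rewrite -[leRHS]mulr1 ler_wpM2l.
Qed.

Lemma integral_indicM d' (T : measurableType d')
    (mu : {measure set T -> \bar R}) (w : T -> R) (A : set T) :
  \int[mu]_(x in A) (w x)%:E = \int[mu]_x (w x * \1_A x)%:E.
Proof.
rewrite integral_mkcond; apply: eq_integral => x _.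
by rewrite patchE indicE; case: ifP => _; rewrite ?mulr1 ?mulr0.
Qed.

Variable d : nat.
Local Notation mu := (lebesgue_rV R d).

Lemma ray_exhaust (x : 'rV[R]_d) :
  \forall n \near \oo, ray (const_mx (- n%:R)%R) x.
Proof.
pose M := (\sum_(j < d) `|x ord0 j|)%R.
exists (Num.truncn M).+1 => // n /= Mn j; rewrite mxE ltrNl.
apply: (@lt_le_trans _ _ (Num.truncn M).+1%:R); last by rewrite ler_nat.
apply: le_lt_trans (truncnS_gt M).
rewrite /M (bigD1 j)//= -normrN; apply: (le_trans (ler_norm _)).
by rewrite lerDl sumr_ge0.
Qed.

(** Products of half-lines generate the sigma-algebra: a half-space in one
    coordinate is the increasing union of the products whose other half-lines
    start at - n. *)
Lemma measurable_rays (A : set 'rV[R]_d) : measurable A -> <<s range (@ray R d) >> A.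
Proof.
suff ray_coord (i : 'I_d) : measurable_fun
    [set: g_sigma_algebraType (range (@ray R d))]
    (fun x : g_sigma_algebraType (range (@ray R d)) => (x : 'rV[R]_d) ord0 i).
  move: A; apply: smallest_sub; first exact: smallest_sigma_algebra.
  move=> A; rewrite -bigcup_seq/= => -[i _ [B mB <-]].
  exact: (ray_coord i).
apply: (measurability _ (RGenOInfty.measurableE R)) => _ [_ [c ->] <-].
rewrite setTI (_ : _ @^-1` _ = \bigcup_n
    ray (\row_j (if j == i then c else - n%:R))%R).
  apply: bigcupT_measurable => n; apply: sub_sigma_algebra.
  by exists (\row_j (if j == i then c else - n%:R))%R.
apply/seteqP; split => x /=; rewrite in_itv/= andbT.
  move=> cx; have [n _ /(_ n (leqnn n)) hn] := ray_exhaust x.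
  exists n => // j; rewrite mxE; case: eqP => [->//|_].
  by have := hn j; rewrite mxE.
by move=> [n _ /(_ i)]; rewrite mxE eqxx.
Qed.

Lemma setI_closed_rays : setI_closed (range (@ray R d)).
Proof.
move=> _ _ [p _ <-] [q _ <-].
exists (\row_j Num.max (p ord0 j) (q ord0 j))%R => //.
apply/seteqP; split => x /=.
  by move=> xpq; split => j; move: (xpq j); rewrite mxE gt_max => /andP[].
by move=> [xp xq] j; rewrite mxE gt_max xp xq.
Qed.

Lemma measurable_ray q : measurable (@ray R d q).
Proof.
rewrite (_ : ray q = \bigcap_(i in [set: 'I_d])
    (fun x : 'rV[R]_d => x ord0 i) @^-1` `]q ord0 i, +oo[).
  apply: fin_bigcap_measurable => // i _; rewrite -[X in measurable X]setTI.
  by apply: measurable_coord.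
by apply/seteqP; split => x /= xq i; [move=> _|];
  have := xq i; rewrite /= in_itv/= andbT => //; apply.
Qed.

(** A Dynkin class argument: products of half-lines are stable under
    intersection, and the sets over which [w] has integral zero form a Dynkin
    class. *)
Lemma integral_rays_eq0 (w : 'rV[R]_d -> R) :
  mu.-integrable setT (EFin \o w) ->
  (forall q, \int[mu]_(x in ray q) (w x)%:E = 0) ->
  {ae mu, forall x, w x = 0%R}.
Proof.
move=> iw ray0.
have all0 : forall E, measurable E -> \int[mu]_(x in E) (w x)%:E = 0.
  move=> E mE; move: (measurable_rays mE).
  rewrite -(setI_closed_g_dynkin_g_sigma_algebra setI_closed_rays).
  suff : <<d range (@ray R d) >> `<=`
      [set E | measurable E /\ \int[mu]_(x in E) (w x)%:E = 0].
    by move=> /[apply] -[].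
  have T0 : \int[mu]_x (w x)%:E = 0.
    pose q n : 'rV[R]_d := const_mx (- n%:R)%R.
    have cv : \int[mu]_x (w x * \1_(ray (q n)) x)%:E @[n --> \oo] -->
        \int[mu]_x (w x * cst 1 x)%:E.
      apply: integral_bounded_weights_cvg => //.
      - by move=> n; apply: measurable_indic; exact: measurable_ray.
      - by move=> n x; rewrite indicE; case: (_ \in _); rewrite ?normr1 ?normr0.
      - move=> x; apply: cvg_near_cst.
        by apply: filterS (ray_exhaust x) => n qx; rewrite indicE mem_set.
    have cv0 : \int[mu]_x (w x * \1_(ray (q n)) x)%:E @[n --> \oo] --> 0.
      by under eq_fun do rewrite -integral_indicM ray0; exact: cvg_cst.
    transitivity (\int[mu]_x (w x * cst 1%R x)%:E); last exact: (cvg_unique _ cv cv0).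
    by apply: eq_integral => x _; rewrite /= mulr1.
  apply: smallest_sub; last by move=> _ [q _ <-]; split => //; exact: measurable_ray.
  split; first by split.
  - move=> A [mA A0]; split; first exact: measurableC.
    move: T0; rewrite -(setUv A) integral_setU//.
    + by rewrite A0 add0e.
    + exact: measurableC.
    + by rewrite setUv; exact: measurable_int iw.
    + by apply/disj_setPCl.
  - move=> F tF F0; split; first by apply: bigcupT_measurable => n; have [] := F0 n.
    rewrite integral_bigcup//; last 2 first.
      by move=> n; have [] := F0 n.
      by apply: integrableS iw => //; apply: bigcupT_measurable => n; have [] := F0 n.
    by apply: eseries0 => n _ _; have [] := F0 n.
have := @integral_ae_eq _ _ _ mu setT measurableT (cst 0) (EFin \o w) iw.
move=> /(_ (measurable_cst _)) H.
have : ae_eq mu setT (EFin \o w) (cst 0).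
  by apply: H => E _ mE; rewrite integral0 all0.
by apply: filterS => x /(_ I) [].
Qed.

(** A form of the fundamental lemma of the calculus of variations: dominated
    convergence replaces the bumps by indicators of products of half-lines. *)
Lemma ray_bumps_eq0 (w : 'rV[R]_d -> R) :
  mu.-integrable setT (EFin \o w) ->
  (forall n q, \int[mu]_x (w x * ray_bump n q x)%:E = 0) ->
  {ae mu, forall x, w x = 0%R}.
Proof.
move=> iw h; apply: integral_rays_eq0 => // q.
have cv : \int[mu]_x (w x * ray_bump n q x)%:E @[n --> \oo] -->
    \int[mu]_x (w x * \1_(ray q) x)%:E.
  apply: integral_bounded_weights_cvg => //.
  - by move=> n; apply: smooth_expr_measurable; exact: smooth_expr_ray_bump.
  - by apply: measurable_indic; exact: measurable_ray.
  - by move=> n x; have /andP[b0 b1] := ray_bump_bound n q x; rewrite ger0_norm.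
  - by move=> x; exact: ray_bump_cvg.
have cv0 : \int[mu]_x (w x * ray_bump n q x)%:E @[n --> \oo] --> 0.
  by under eq_fun do rewrite h; exact: cvg_cst.
by rewrite integral_indicM; exact: (cvg_unique _ cv cv0).
Qed.

End vanishing_integrals.

(** * Integrals along lines *)

Section line_integrals.
Context {R : realType} {d : nat}.
Local Open Scope ereal_scope.
Local Notation mu := (lebesgue_rV R d).
Local Notation leb := (@lebesgue_measure R).
Implicit Types (f g psi : 'rV[R]_d -> R) (h x : 'rV[R]_d) (s t : R).

Lemma integrable_bounded_mul d' (T : measurableType d')
    (m : {measure set T -> \bar R}) (k w : T -> R) (M : R) :
  m.-integrable setT (EFin \o w) -> measurable_fun setT k ->
  (forall y, (`|k y| <= M)%R) -> m.-integrable setT (fun y => (k y * w y)%:E).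
Proof.
move=> iw mk kM.
have mw : measurable_fun setT w by apply/measurable_EFinP; exact: measurable_int iw.
apply: (@le_integrable _ _ _ _ _ _ _ (fun y => M%:E * `|w y|%:E)) => //.
- by apply/measurable_EFinP; exact: measurable_funM.
- move=> x _ /=; rewrite lee_fin !normrM normr_id ler_wpM2r//.
  exact: le_trans (kM x) (ler_norm _).
- by apply: integrableZl => //; exact: (integrable_abse iw).
Qed.

Lemma measurable_line h : measurable_fun setT
  (fun p : 'rV[R]_d * measurableTypeR R => (p.1 + p.2 *: h)%R).
Proof.
apply: measurable_fun_rVP => i; under eq_fun do rewrite !mxE.
apply: measurable_funD.
  by apply: (measurableT_comp (@measurable_coord R d i)); exact: measurable_fst.
by apply: measurable_funM => //; exact: measurable_snd.
Qed.

Lemma measurable_indic_segment d' (T : measurableType d') (a b : T -> R) :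
  measurable_fun setT a -> measurable_fun setT b ->
  measurable_fun setT (fun y => \1_`[0%R, b y] (a y) : R).
Proof.
move=> ma mb; rewrite (_ : (fun _ => _) = fun y =>
    if (0 <= a y) && (a y <= b y) then 1 else 0)%R; last first.
  by apply/funext => y; rewrite indicE mem_setE in_itv/=; case: ifP.
by apply: measurable_fun_ifT => //; apply: measurable_and;
  apply: measurable_fun_ler.
Qed.

(** Restricting time to a bounded interval makes a uniform bound on the
    space integrals enough for joint integrability. *)
Lemma integrable_prod_itv (F : 'rV[R]_d * measurableTypeR R -> R) (M s : R) :
  measurable_fun setT F ->
  (forall t, t \in `[0, s]%R -> \int[mu]_x `|(F (x, t))%:E| <= M%:E) ->
  (mu \x leb).-integrable setT (fun p => (F p * \1_`[0%R, s] p.2)%:E).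
Proof.
move=> mF FM.
have m1 : measurable_fun setT
    (fun p : 'rV[R]_d * measurableTypeR R => \1_`[0%R, s] p.2 : R).
  by apply: (@measurable_indic_segment _ _ snd (cst s)) => //; exact: measurable_snd.
have mF1 : measurable_fun setT (fun p => (F p * \1_`[0%R, s] p.2)%:E).
  by apply/measurable_EFinP; exact: measurable_funM.
apply/(integrable21ltyP _ _ mF1).
apply: (@le_lt_trans _ _ (\int[leb]_t (M * \1_`[0%R, s] t)%:E)).
  apply: ge0_le_integral => //.
  - by move=> t _; exact: integral_ge0.
  - apply: (measurable_fun_fubini_tonelli_G
      (fun p : 'rV[R]_d * measurableTypeR R => `|(F p * \1_`[0%R, s] p.2)%:E|)) => //.
    exact: measurableT_comp.
  - by apply/measurable_EFinP; exact: measurable_funM.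
  - move=> t _; rewrite indicE; have [ts|ts] := boolP (t \in _).
      rewrite mulr1; under eq_integral do rewrite mulr1.
      by apply: FM; exact: set_mem.
    rewrite mulr0 integral0_eq// => x _.
    by rewrite mulr0 abse0.
rewrite -(integral_indicM leb (cst M)).
rewrite [ltLHS](_ : _ = M%:E * leb `[0%R, s]); last first.
  by rewrite -[LHS]/(\int[leb]_(x in `[0%R, s]) cst M%:E x) integral_cst.
rewrite lebesgue_measure_itv.
by case: ifP => _; rewrite ?mule0 ?ltry// -EFinD -EFinM ltry.
Qed.

Definition line_integral g h s x : R :=
  (\int[leb]_(t in `[0%R, s]) g (x + t *: h))%R.

Lemma line_integralE g h s x : line_integral g h s x =
  fine (\int[leb]_t (g (x + t *: h) * \1_`[0%R, s] t)%:E).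
Proof.
by rewrite /line_integral /Rintegral integral_indicM.
Qed.

Lemma measurable_line_integral g h : measurable_fun setT g ->
  measurable_fun setT
    (fun p : 'rV[R]_d * measurableTypeR R => line_integral g h p.2 p.1).
Proof.
move=> mg; under eq_fun do rewrite line_integralE.
apply: measurableT_comp => //.
pose F (q : ('rV[R]_d * measurableTypeR R) * measurableTypeR R) : \bar R :=
  (g (q.1.1 + q.2 *: h) * \1_`[0%R, q.1.2] q.2)%:E.
have mF : measurable_fun setT F.
  apply/measurable_EFinP; apply: measurable_funM.
    apply: (measurableT_comp mg).
    have mp : measurable_fun setT
        (fun q : ('rV[R]_d * measurableTypeR R) * measurableTypeR R => (q.1.1, q.2)).
      apply: measurable_fun_pair; last exact: measurable_snd.
      by apply: measurableT_comp => //; exact: measurable_fst.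
    exact: (measurableT_comp (measurable_line h) mp).
  apply: measurable_indic_segment; first exact: measurable_snd.
  by apply: measurableT_comp; [exact: measurable_snd|exact: measurable_fst].
rewrite (_ : (fun _ => _) = fubini_F leb F^\+ \- fubini_F leb F^\-); last first.
  apply/funext => p; rewrite integralE /fubini_F.
  by congr (_ - _); apply: eq_integral => t _; rewrite ?funeposE ?funenegE.
apply: emeasurable_funB.
- by apply: measurable_fun_fubini_tonelli_F => //; exact: measurable_funepos.
- by apply: measurable_fun_fubini_tonelli_F => //; exact: measurable_funeneg.
Qed.

End line_integrals.

(** * Weak derivatives along lines *)

Section weak_line.
Context {R : realType} {d : nat}.
Local Open Scope ereal_scope.
Local Notation mu := (lebesgue_rV R d).
Local Notation leb := (@lebesgue_measure R).
Implicit Types (f g psi : 'rV[R]_d -> R) (h x : 'rV[R]_d) (s t : R).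

(** The integrand is the derivative of t |-> c psi(x - t h). *)
Lemma FTC_line psi h x s (c : R) : (0 <= s)%R -> smooth_expr psi ->
  \int[leb]_(t in `[0%R, s]) (- (c * 'D_h psi (x - t *: h)))%:E =
  (c * (psi (x - s *: h) - psi x))%:E.
Proof.
rewrite le_eqVlt => /predU1P[<- _|s0 spsi].
  by rewrite set_itv1 integral_set1 scale0r subr0 subrr mulr0.
pose F t := (c * psi (x - t *: h))%R.
have dF (t : R) : is_derive t 1%R F (- (c * 'D_h psi (x - t *: h)))%R.
  have dl := is_derive_line h x t spsi.
  by apply: is_derive_eq; rewrite /GRing.scale/= mulrN.
have cF t : {for t, continuous F}.
  by apply/differentiable_continuous/derivable1_diffP; case: (dF t).
rewrite (@continuous_FTC2 _ _ F)//.
- by rewrite /F scale0r subr0 -EFinB mulrBr.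
- apply: continuous_subspaceT => t.
  have dDl := is_derive_line h x t (smooth_expr_derive h spsi).
  apply/differentiable_continuous/derivable1_diffP.
  by apply: derivableN; apply: derivableM => //; case: dDl.
- split=> [t _||]; first by case: (dF t).
  + exact/cvg_at_right_filter/cF.
  + exact/cvg_at_left_filter/cF.
- by move=> t _; rewrite derive1E; case: (dF t).
Qed.

Lemma integrable_line_prod g h s : (0 <= s)%R -> mu.-integrable setT (EFin \o g) ->
  (mu \x leb).-integrable setT
    (fun p => (g (p.1 + p.2 *: h) * \1_`[0%R, s] p.2)%:E).
Proof.
move=> s0 ig; have mg : measurable_fun setT g.
  by apply/measurable_EFinP; exact: measurable_int ig.
have [_ goo] := integrableP _ _ _ ig.
apply: (@integrable_prod_itv _ _ _ (fine (\int[mu]_x `|(g x)%:E|))).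
  exact: (measurableT_comp mg (measurable_line h)).
move=> t _; rewrite fineK ?ge0_fin_numE// ?integral_ge0//=.
rewrite (@ge0_integral_rV_shift _ _ (t *: h) (fun x => `|(g x)%:E|))//.
by apply: measurableT_comp => //; exact/measurable_EFinP.
Qed.

Lemma ae_integrable_line g h s : (0 <= s)%R -> mu.-integrable setT (EFin \o g) ->
  {ae mu, forall x, leb.-integrable `[0%R, s] (fun t => (g (x + t *: h))%:E)}.
Proof.
move=> s0 ig.
apply: filterS (ae_integrable1 (integrable_line_prod h s0 ig)) => x ix.
apply/integrable_mkcond => //; apply: eq_integrable ix => // t _.
by rewrite patchE indicE; case: ifP => _; rewrite ?mulr1 ?mulr0.
Qed.

Lemma integrable_line_integral g h s : (0 <= s)%R ->
  mu.-integrable setT (EFin \o g) ->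
  mu.-integrable setT (EFin \o line_integral g h s).
Proof.
move=> s0 ig; have mg : measurable_fun setT g.
  by apply/measurable_EFinP; exact: measurable_int ig.
apply: le_integrable (integrable_fubini_F (integrable_line_prod h s0 ig)) => //.
  apply/measurable_EFinP.
  exact: (measurableT_comp (measurable_line_integral h mg) (pair2_measurable s)).
move=> x _; rewrite /fubini_F /= line_integralE.
by case: (\int[leb]_t _) => [r| |]//=; rewrite normr0 leey.
Qed.

(** Both sides of the hypothesis are integrated over t in [0, s].  On the left,
    Fubini and [FTC_line] produce the increment psi(x - s h) - psi(x); on the
    right, translating x by t h moves the time dependence from [psi] to [g].
    A last translation moves the increment from [psi] to [f]. *)
Lemma weak_line f g psi h s (M : R) : (0 <= s)%R ->
  mu.-integrable setT (EFin \o f) -> mu.-integrable setT (EFin \o g) ->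
  smooth_expr psi -> (forall x, (`|psi x| <= M)%R) ->
  (forall x, (`|'D_h psi x| <= M)%R) ->
  (forall t, t \in `[0, s]%R ->
    \int[mu]_x (- (f x * 'D_h psi (x - t *: h)))%:E =
    \int[mu]_x (g x * psi (x - t *: h))%:E) ->
  \int[mu]_x (psi x * (f (x + s *: h) - f x - line_integral g h s x))%:E = 0.
Proof.
move=> s0 fi ig spsi psiM DpsiM weak.
have mf : measurable_fun setT f by apply/measurable_EFinP; exact: measurable_int fi.
have mg : measurable_fun setT g by apply/measurable_EFinP; exact: measurable_int ig.
have mpsi : measurable_fun setT psi by exact: smooth_expr_measurable.
have mDpsi : measurable_fun setT ('D_h psi).
  by apply: smooth_expr_measurable; exact: smooth_expr_derive.
have mlineN : measurable_fun setT
    (fun p : 'rV[R]_d * measurableTypeR R => (p.1 - p.2 *: h)%R).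
  by under eq_fun do rewrite -scalerN; exact: measurable_line.
have M0 : (0 <= M)%R by apply: le_trans (psiM 0%R).
have bounded_prod (w : 'rV[R]_d -> R) (a : R -> 'rV[R]_d)
      (F : 'rV[R]_d * measurableTypeR R -> R) :
    mu.-integrable setT (EFin \o w) -> measurable_fun setT F ->
    (forall t x, `|F (x, t)| <= M * `|w (x + a t)|)%R ->
    (mu \x leb).-integrable setT (fun p => (F p * \1_`[0%R, s] p.2)%:E).
  move=> iw mF FM; have [mw woo] := integrableP _ _ _ iw.
  have maw : measurable_fun setT (fun x => `|(w x)%:E|) by exact: measurableT_comp.
  apply: (@integrable_prod_itv _ _ _ (M * fine (\int[mu]_x `|(w x)%:E|))) => //.
  move=> t _; rewrite EFinM fineK ?ge0_fin_numE ?integral_ge0//.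
  rewrite -(ge0_integral_rV_shift (a t) maw)//.
  have maw' : measurable_fun setT (fun x => `|(w (x + a t)%R)%:E|).
    by apply: (measurableT_comp maw); exact: measurable_rV_shift.
  rewrite -ge0_integralZl//; apply: ge0_le_integral => //.
  - apply: measurableT_comp => //; apply/measurable_EFinP.
    exact: (measurableT_comp mF (pair2_measurable t)).
  - exact: measurable_funeM.
  - by move=> x _; rewrite -EFinM lee_fin; exact: FM.
pose K1 (p : 'rV[R]_d * measurableTypeR R) :=
  (- (f p.1 * 'D_h psi (p.1 - p.2 *: h)) * \1_`[0%R, s] p.2)%:E.
pose K2 (p : 'rV[R]_d * measurableTypeR R) :=
  (g (p.1 + p.2 *: h) * psi p.1 * \1_`[0%R, s] p.2)%:E.
have iK1 : (mu \x leb).-integrable setT K1.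
  apply: (bounded_prod f (cst 0%R)) => //.
    apply: measurable_funN; apply: measurable_funM.
      by apply: (measurableT_comp mf); exact: measurable_fst.
    exact: (measurableT_comp mDpsi mlineN).
  by move=> t x; rewrite /= addr0 normrN normrM mulrC ler_wpM2r.
have iK2 : (mu \x leb).-integrable setT K2.
  apply: (bounded_prod g (fun t => t *: h)) => //.
    apply: measurable_funM; first exact: (measurableT_comp mg (measurable_line h)).
    by apply: (measurableT_comp mpsi); exact: measurable_fst.
  by move=> t x; rewrite /= normrM mulrC ler_wpM2r.
have eK1 : \int[mu]_x (f x * (psi (x - s *: h) - psi x))%:E =
    \int[mu]_x \int[leb]_t K1 (x, t).
  by apply: eq_integral => x _; rewrite -(FTC_line h x (f x) s0 spsi) integral_indicM.
have eK2 : \int[mu]_x \int[leb]_t K2 (x, t) =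
    \int[mu]_x (psi x * line_integral g h s x)%:E.
  apply: ae_eq_integral => //.
  - exact: (measurable_fubini_F iK2).
  - apply/measurable_EFinP/measurable_funM => //.
    exact: (measurableT_comp (measurable_line_integral h mg) (pair2_measurable s)).
  - apply: filterS (ae_integrable_line h s0 ig) => x ix _.
    rewrite /line_integral EFinM /Rintegral fineK; last exact: integrable_fin_num.
    rewrite -integralZl// -integral_indicM; apply: eq_integral => t _.
    by rewrite -EFinM mulrC.
have K12 : \int[mu]_x \int[leb]_t K1 (x, t) = \int[mu]_x \int[leb]_t K2 (x, t).
  rewrite (Fubini iK1) (Fubini iK2); apply: eq_integral => t _.
  rewrite /K1 /K2 /= indicE; have [/set_mem ts|_] := boolP (t \in _); last first.
    by under eq_integral do rewrite mulr0; under [RHS]eq_integral do rewrite mulr0.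
  under eq_integral do rewrite mulr1; under [RHS]eq_integral do rewrite mulr1.
  rewrite weak//.
  rewrite -(@integral_rV_shift _ _ (t *: h) (fun x => (g x * psi (x - t *: h))%:E)).
    by apply: eq_integral => x _; rewrite addrK.
  have mpsit : measurable_fun setT (fun x => psi (x - t *: h)%R).
    by apply: (measurableT_comp mpsi); exact: (measurable_rV_shift (- (t *: h))).
  by apply: measurableT_comp => //; exact: (measurable_funM mg mpsit).
have shiftM k : mu.-integrable setT (fun x => (psi (x - k) * f x)%:E).
  apply: (integrable_bounded_mul fi (M := M)) => //.
  by apply: (measurableT_comp mpsi); exact: (measurable_rV_shift (- k)).
have mfs : measurable_fun setT (fun x => f (x + s *: h)%R).
  by apply: (measurableT_comp mf); exact: measurable_rV_shift.
have ifs : mu.-integrable setT (fun x => (psi x * f (x + s *: h))%:E).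
  apply: (integrable_bounded_mul (w := fun x => f (x + s *: h)%R) (M := M)) => //.
  exact: (integrable_rV_shift (s *: h) fi).
have iF : mu.-integrable setT (fun x => (psi x * f x)%:E).
  exact: (integrable_bounded_mul fi (M := M)).
have iL : mu.-integrable setT (fun x => (psi x * line_integral g h s x)%:E).
  exact: (integrable_bounded_mul (integrable_line_integral h s0 ig) (M := M)).
under eq_integral do rewrite !mulrBr !EFinB.
rewrite integralB//; last by apply: integrableB.
rewrite -eK2 -K12 -eK1 integralB//.
under [X in _ - X]eq_integral do rewrite mulrBr EFinB mulrC [X in _ - X%:E]mulrC.
rewrite integralB//.
(* Translating by s h turns psi(x - s h) f(x) into psi(x) f(x + s h). *)
rewrite -[X in _ - (X - _)](@integral_rV_shift _ _ (s *: h)); last first.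
  exact: measurable_int (shiftM _).
under [X in _ - (X - _)]eq_integral do rewrite addrK.
rewrite subee// fin_numB !integrable_fin_num//.
Qed.

End weak_line.

(** * Sobolev functions along segments of the ball *)

Section ball_sobolev.
Context {R : realType} {d : nat}.
Local Open Scope ereal_scope.
Local Notation mu := (lebesgue_rV R d).
Local Notation leb := (@lebesgue_measure R).
Local Notation B := (@unit_ball R d).
Implicit Types (f g psi u : 'rV[R]_d -> R) (Du : 'rV[R]_d -> 'rV[R]_d) (h x : 'rV[R]_d) (s t : R).

Lemma measurable_unit_ball : measurable B.
Proof.
rewrite (_ : B = (@sqnorm R d) @^-1` `]-oo, 1%R[).
  rewrite -[X in measurable X]setTI.
  by apply: (smooth_expr_measurable smooth_expr_sqnorm).
by apply/seteqP; split => x /=; rewrite in_itv/= => /unit_ballE.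
Qed.

Definition cube (r : R) : set 'rV[R]_d := [set x | forall i, `[(- r)%R, r]%classic (x ord0 i)].

Lemma measurable_cube r : measurable (cube r).
Proof.
rewrite (_ : cube r = \bigcap_(i in [set: 'I_d])
    (fun x : 'rV[R]_d => x ord0 i) @^-1` `[(- r)%R, r]%classic).
  apply: fin_bigcap_measurable => // i _; rewrite -[X in measurable X]setTI.
  by apply: measurable_coord.
by apply/seteqP; split => x /= xq i; [move=> _|]; apply: xq.
Qed.

Lemma cube_lty r : mu (cube r) < +oo.
Proof.
rewrite -ge0_fin_numE// (@lebesgue_rV_box _ _ (fun=> `[(- r)%R, r]%classic))//.
apply: (big_ind (fun y : \bar R => y \is a fin_num)) => //; first exact: fin_numM.
by move=> i _; rewrite lebesgue_measure_itv; case: ifP.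
Qed.

Lemma unit_ball_cube x : B x -> cube 1 x.
Proof.
move=> /unit_ballE x1 i; rewrite /= in_itv/=.
have : (x ord0 i ^+ 2 <= sqnorm x)%R.
  rewrite /sqnorm (bigD1 i)//= lerDl.
  by apply: sumr_ge0 => j _; exact: sqr_ge0.
by move: (x ord0 i) => y ?; apply/andP; split; nra.
Qed.

Lemma unit_ball_lty : mu B < +oo.
Proof.
apply: le_lt_trans (cube_lty 1); apply: le_measure.
- by rewrite inE; exact: measurable_unit_ball.
- by rewrite inE; exact: measurable_cube.
- exact: unit_ball_cube.
Qed.

Lemma L2_measurable u : L2 B u -> measurable_fun setT (u \_ B).
Proof. by rewrite /L2 inE => /andP[]; rewrite inE. Qed.

(** The ball has finite measure, and |y| <= 1 + y ^ 2. *)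
Lemma L2_integrable u : L2 B u -> mu.-integrable setT (EFin \o (u \_ B)).
Proof.
move=> uL2; have mfu := L2_measurable uL2.
apply: (@le_integrable _ _ _ _ _ _ _
    (fun x => (\1_B x)%:E + ((u \_ B) x ^+ 2)%:E)) => //.
- exact/measurable_EFinP.
- move=> x _ /=; rewrite lee_fin [leRHS]ger0_norm; last first.
    by rewrite addr_ge0// ?sqr_ge0.
  rewrite indicE patchE; case: ifPn => xB; last by rewrite normr0 expr0n addr0.
  rewrite -real_normK ?num_real// mulr1n.
  move: (`|u x|)%R (normr_ge0 (u x)) => y y0; have := sqr_ge0 (y - 1); nra.
- apply: integrableD => //; last exact: (Lfun2_integrable_sqr uL2).
  have mB := measurable_unit_ball; apply/integrableP; split.
    by apply/measurable_EFinP; exact: measurable_indic.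
  under eq_integral do rewrite gee0_abs ?lee_fin//.
  by rewrite integral_indic// setIT unit_ball_lty.
Qed.

Lemma derive_comp_shift f v h x : 'D_v (fun y => f (y + h)%R) x = 'D_v f (x + h)%R.
Proof.
rewrite /derive (_ : (fun t : R => _) =
  fun t => t^-1 *: (f (t *: v + (x + h)) - f (x + h)))%R //.
by apply/funext => t; rewrite /= addrA.
Qed.

Definition dir_grad Du h x : R :=
  (\sum_(i < d) h ord0 i * ((fun y => Du y ord0 i) \_ B) x)%R.

Lemma dir_grad_integrable Du h : (forall i, L2 B (fun x => Du x ord0 i)) ->
  mu.-integrable setT (EFin \o dir_grad Du h).
Proof.
move=> DuL2; rewrite (_ : _ \o _ = fun x => \sum_(i < d)
    ((h ord0 i)%:E * (((fun y => Du y ord0 i) \_ B) x)%:E)); last first.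
  by apply/funext => x /=; rewrite /dir_grad -sumEFin.
by apply: integrable_sum => // i _; apply: integrableZl => //; exact: L2_integrable.
Qed.

(** The sign is carried by the left integrand so that, for a translate of the
    test function, this integrand is the one of [FTC_line]. *)
Lemma weak_gradient_dir u Du h psi (c : R) : L2 B u -> L2_weak_gradient B u Du ->
  (c < 1)%R -> smooth_expr psi -> (forall x, psi x != 0%R -> sqnorm x <= c)%R ->
  \int[mu]_x (- ((u \_ B) x * 'D_h psi x))%:E =
  \int[mu]_x (dir_grad Du h x * psi x)%:E.
Proof.
move=> uL2 [DuL2 wu] c1 spsi psic.
have sD v : smooth_expr ('D_v psi) by exact: smooth_expr_derive.
have bnd f : smooth_expr f -> (forall x, f x != 0%R -> sqnorm x <= c)%R ->
    forall w, mu.-integrable setT (EFin \o w) ->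
    mu.-integrable setT (fun x => (w x * f x)%:E).
  move=> sf fc w iw; have [M fM] := bump_bounded sf fc.
  under eq_fun do rewrite mulrC.
  by apply: (integrable_bounded_mul iw _ fM); exact: smooth_expr_measurable.
have iu i : mu.-integrable setT (fun x => ((u \_ B) x * partial i psi x)%:E).
  by apply: bnd; [exact: sD|exact: derive_bump|exact: L2_integrable].
have iDu i : mu.-integrable setT
    (fun x => (((fun y => Du y ord0 i) \_ B) x * psi x)%:E).
  by apply: bnd => //; exact: L2_integrable.
have test : test_function B psi by exact: (test_function_bump c1).
have wi i : \int[mu]_x ((u \_ B) x * partial i psi x)%:E =
    - \int[mu]_x (((fun y => Du y ord0 i) \_ B) x * psi x)%:E.
  have := wu i psi test.
  rewrite Rintegral_mkcond [in RHS]Rintegral_mkcond.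
  rewrite (_ : (fun x => u x * partial i psi x)%R \_ B =
    fun x => ((u \_ B) x * partial i psi x)%R); last first.
    by apply/funext => x; rewrite !patchE; case: ifP => _; rewrite ?mul0r.
  rewrite (_ : (fun x => Du x ord0 i * psi x)%R \_ B =
    fun x => (((fun y => Du y ord0 i) \_ B) x * psi x)%R); last first.
    by apply/funext => x; rewrite !patchE; case: ifP => _; rewrite ?mul0r.
  rewrite /Rintegral => fineE.
  rewrite -[LHS]fineK; last by apply: integrable_fin_num.
  by rewrite fineE EFinN fineK//; apply: integrable_fin_num.
rewrite (eq_integral (fun x => \sum_(i < d)
    ((- h ord0 i)%:E * ((u \_ B) x * partial i psi x)%:E))); last first.
  move=> x _; rewrite deriveE_partial; last exact: smooth_expr_differentiable.
  rewrite mulr_sumr -sumrN -sumEFin; apply: eq_bigr => i _.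
  by rewrite -EFinM mulrCA mulNr.
rewrite [RHS](eq_integral (fun x => \sum_(i < d)
    ((h ord0 i)%:E * (((fun y => Du y ord0 i) \_ B) x * psi x)%:E))); last first.
  move=> x _; rewrite /dir_grad mulr_suml -sumEFin; apply: eq_bigr => i _.
  by rewrite -EFinM mulrA.
rewrite !integral_sum//; last 2 first.
- by move=> i; exact: integrableZl.
- by move=> i; exact: integrableZl.
apply: eq_bigr => i _; rewrite !integralZl// wi.
by rewrite EFinN muleN mulNe oppeK.
Qed.

(** The bump [inner_bump] localizes to points where both ends of the segment
    lie well inside the ball, and is positive there; by convexity its
    translates along the segment are supported in a smaller concentric ball.
    The factors [ray_bump] then separate integrable functions. *)
Lemma line_identity u Du h s : L2 B u -> L2_weak_gradient B u Du -> (0 <= s <= 1)%R ->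
  {ae mu, forall x, B x -> B (x + h)%R ->
    ((u \_ B) (x + s *: h) - (u \_ B) x = line_integral (dir_grad Du h) h s x)%R}.
Proof.
move=> uL2 wu /andP[s0 s1].
have iu := L2_integrable uL2.
have ig := dir_grad_integrable h wu.1.
pose D x := ((u \_ B) (x + s *: h) - (u \_ B) x - line_integral (dir_grad Du h) h s x)%R.
have iD : mu.-integrable setT (EFin \o D).
  rewrite (_ : _ \o _ = (fun x => ((u \_ B) (x + s *: h)%R)%:E) \-
    (EFin \o (u \_ B)) \- (EFin \o line_integral (dir_grad Du h) h s))//.
  apply: integrableB => //; last exact: integrable_line_integral.
  by apply: integrableB => //; exact: (integrable_rV_shift (s *: h) iu).
have all_m : forall m, {ae mu, forall x, (inner_bump m h x * D x = 0)%R}.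
  move=> m; apply: ray_bumps_eq0.
    apply: (integrable_bounded_mul iD (M := 1%R)).
      by apply: smooth_expr_measurable; exact: smooth_expr_inner_bump.
    by move=> x; have /andP[b0 b1] := inner_bump_bound m h x; rewrite ger0_norm.
  move=> n q; pose psi x := (inner_bump m h x * ray_bump n q x)%R.
  pose c : R := (1 - m.+1%:R^-1)%R.
  have c1 : (c < 1)%R by rewrite ltrBlDr ltrDl invr_gt0.
  have spsi : smooth_expr psi.
    by apply: smooth_exprM; [exact: smooth_expr_inner_bump|exact: smooth_expr_ray_bump].
  have psic x : (psi x != 0 -> sqnorm x <= c /\ sqnorm (x + h) <= c)%R.
    by rewrite mulf_eq0 negb_or => /andP[/inner_bump_neq0].
  have psic1 x : (psi x != 0 -> sqnorm x <= c)%R by move=> /psic[].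
  have [M hM] := bump_bounded (smooth_expr_derive h spsi) (@derive_bump _ _ _ _ h psic1).
  have [M' hM'] := bump_bounded spsi psic1.
  under eq_integral do rewrite mulrAC.
  apply: (@weak_line _ _ _ _ psi h s (Num.max M M')) => //.
  - by move=> x; rewrite le_max hM' orbT.
  - by move=> x; rewrite le_max hM.
  move=> t; rewrite in_itv/= => /andP[t0 ts].
  transitivity (\int[mu]_x (- ((u \_ B) x * 'D_h (fun y => psi (y - t *: h)%R) x))%:E).
    by apply: eq_integral => x _; rewrite derive_comp_shift.
  apply: (weak_gradient_dir h uL2 wu c1); first exact: smooth_expr_shift.
  move=> x /psic[xc xhc]; rewrite -(subrK (t *: h) x).
  by apply: sqnorm_segment_le => //; rewrite t0 (le_trans ts).
apply: filterS (ae_foralln all_m) => x Dx Bx Bxh.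
have [m m0] := inner_bump_exists Bx Bxh.
by move/eqP: (Dx m); rewrite mulf_eq0 (negbTE m0)/= subr_eq0 => /eqP.
Qed.

End ball_sobolev.

(** * Crossing a band in one dimension *)

Section excursion.
Context {R : realType}.
Local Notation leb := (@lebesgue_measure R).
Implicit Types (F g v : R -> R) (a b c s t : R).

Lemma compact_level_segment F (C : set R) (lo hi : R) : closed C ->
  {within `[lo, hi], continuous F} -> compact (`[lo, hi] `&` F @^-1` C).
Proof.
move=> cC cF; move/continuous_closedP : cF => /(_ C cC) /closed_subspaceP[V cV VC].
apply: (subclosed_compact _ (@segment_compact _ lo hi)); last by move=> t [].
rewrite setIC -VC; apply: closedI => //; exact: interval_closed.
Qed.

(** Take for s0 the last time before 1 at which F <= a, and for s1 the first
    time after s0 at which b <= F. *)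
Lemma excursion F a b : {within `[0, 1], continuous F} ->
  F 0 <= a -> a < b -> b <= F 1 ->
  exists s0 s1, [/\ 0 <= s0, s0 < s1 & s1 <= 1] /\ [/\ F s0 <= a, b <= F s1 &
    forall s, s0 < s < s1 -> a < F s < b].
Proof.
move=> cF F0 ab F1.
have cid (A : set R) : {within A, continuous (@idfun R)}.
  by apply: continuous_subspaceT => x; exact: cvg_id.
pose K := `[0, 1] `&` F @^-1` [set y | y <= a].
have K0 : K !=set0 by exists 0; split => //=; rewrite in_itv/= lexx ler01.
have cK : compact K by apply: compact_level_segment => //; exact: closed_le.
have [s0 Ks0 s0max] := compact_EVT_max K0 cK (cid K).
move: Ks0; rewrite inE => -[/=]; rewrite in_itv/= => /andP[s00 s01] Fs0.
have c2 : {within `[s0, 1], continuous F}.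
  by apply: continuous_subspaceW cF; apply: subset_itvr; rewrite bnd_simp.
pose L := `[s0, 1] `&` F @^-1` [set y | b <= y].
have L0 : L !=set0 by exists 1; split => //=; rewrite in_itv/= lexx s01.
have cL : compact L by apply: compact_level_segment => //; exact: closed_ge.
have [s1 Ls1 s1min] := compact_EVT_min L0 cL (cid L).
move: Ls1; rewrite inE => -[/=]; rewrite in_itv/= => /andP[s0s1 s11] Fs1.
exists s0, s1; split; split => //.
  rewrite lt_neqAle s0s1 andbT; apply/eqP => s01E.
  by have := le_lt_trans (Fs0 : F s0 <= a) ab; rewrite s01E ltNge => /negP; apply.
move=> s /andP[ss0 ss1]; apply/andP; split; rewrite ltNge; apply/negP => hs.
- have := s0max s; rewrite /=  leNgt ss0 => /(_ _)/negP; apply => //.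
  by rewrite inE; split => //=; rewrite in_itv/= (le_trans s00 (ltW ss0)) (le_trans (ltW ss1)).
- have := s1min s; rewrite /=  leNgt ss1 => /(_ _)/negP; apply => //.
  by rewrite inE; split => //=; rewrite in_itv/= (ltW ss0) (le_trans (ltW ss1)).
Qed.

Local Open Scope ereal_scope.

(** Over the excursion of the continuous primitive from a to b, its increment
    is at most the integral of |g|, and there the integrand on the right is
    |g| almost everywhere. *)
Lemma crossing_le (g v : R -> R) (c a b : R) :
  leb.-integrable `[0%R, 1%R] (EFin \o g) -> measurable_fun setT v ->
  {ae leb, forall s, s \in `[0, 1]%R -> v s = (c + \int[leb]_(t in `[0, s]) g t)%R} ->
  (c <= a)%R -> (a < b)%R -> (b <= c + \int[leb]_(t in `[0, 1]) g t)%R ->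
  (b - a)%:E <= \int[leb]_(s in `[0%R, 1%R]) (if (a < v s < b)%R then `|g s| else 0%R)%:E.
Proof.
move=> ig mv vF ca ab bF.
pose F s := (c + \int[leb]_(t in `[0, s]) g t)%R.
have cF : {within `[0%R, 1%R], continuous F}.
  have := @parameterized_integral_continuous R 0%R 1%R g ler01 ig.
  rewrite /parameterized_integral => cI.
  by move=> s; apply: cvgD; [exact: cvg_cst|exact: cI].
have F0 : (F 0 <= a)%R by rewrite /F set_itv1 Rintegral_set1 addr0.
have [s0 [s1 [[s00 s01 s11] [Fs0 Fs1 Fs]]]] := excursion cF F0 ab bF.
have sub : `]s0, s1] `<=` `[0%R, 1%R].
  by move=> s /=; rewrite !in_itv/= => /andP[? ?]; apply/andP; split; lra.
have ig01 : leb.-integrable `]s0, s1] (EFin \o g) by exact: integrableS ig.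
have mg : measurable_fun (`[0%R, 1%R]%classic : set R) g.
  by apply/measurable_EFinP; exact: measurable_int ig.
have mif : measurable_fun (`[0%R, 1%R]%classic : set R)
    (fun s => (if (a < v s < b)%R then `|g s| else 0%R)%:E).
  apply/measurable_EFinP; apply: measurable_fun_if => //.
  - apply: measurable_funTS; apply: measurable_and; apply: measurable_fun_ltr => //.
  - apply: measurable_funS (measurableT_comp _ mg) => //.
apply: (@le_trans _ _ (\int[leb]_(s in `]s0, s1]) `|g s|%:E)).
  apply: (@le_trans _ _ (`|\int[leb]_(t in `]s0, s1]) g t|%R)%:E); last first.
    by rewrite EFin_normr_Rintegral// le_abse_integral//; exact: measurable_int ig01.
  have <- : (F s1 - F s0 = \int[leb]_(t in `]s0, s1]) g t)%R.
    rewrite /F opprD addrACA subrr add0r Rintegral_itvB ?bnd_simp//; last exact: ltW.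
    by apply: integrableS ig => //; apply: subset_itvl; rewrite bnd_simp.
  by rewrite lee_fin; apply: le_trans (ler_norm _); exact: lerB.
apply: (@le_trans _ _ (\int[leb]_(s in `]s0, s1])
    (if (a < v s < b)%R then `|g s| else 0%R)%:E)); last first.
  apply: ge0_subset_integral => //.
  by move=> s _; rewrite lee_fin; case: ifP.
have ms1 : leb.-negligible [set s1].
  by exists [set s1]; split => //; rewrite lebesgue_measure_set1.
apply: ae_ge0_le_integral => //.
- apply/measurable_EFinP; apply: measurableT_comp => //.
  exact: measurable_funS mg.
- by move=> s _; rewrite lee_fin; case: ifP.
- exact: measurable_funS mif.
apply: negligibleS (negligibleU vF ms1) => s /= ngs.
have [->|/eqP ss1] := pselect (s = s1); first by right.
left => vs; apply: ngs; rewrite /= in_itv/= => /andP[s0s ss1'].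
rewrite vs ?Fs ?s0s ?lt_neqAle ?ss1//.
by rewrite in_itv/= (le_trans s00 (ltW s0s)) (le_trans ss1').
Qed.

End excursion.

(** * The isoperimetric inequality *)

Section null_sections.
Local Open Scope ereal_scope.

Lemma ae_null_xsection d1 d2 (T1 : measurableType d1) (T2 : measurableType d2)
    (R : realType) (m1 : {sigma_finite_measure set T1 -> \bar R})
    (m2 : {sigma_finite_measure set T2 -> \bar R}) (N : set (T1 * T2)) :
  measurable N -> (forall y, m1 (ysection N y) = 0) ->
  {ae m1, forall x, m2 (xsection N x) = 0}.
Proof.
move=> mN N0.
have mx : measurable_fun setT (m2 \o xsection N) by exact: measurable_fun_xsection.
have : \int[m1]_x (m2 \o xsection N) x = 0.
  rewrite -indic_fubini_tonelli_FE// (indic_fubini_tonelli m1 m2 mN).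
  rewrite indic_fubini_tonelli_GE//.
  by rewrite integral0_eq// => y _; exact: N0.
have -> : \int[m1]_x (m2 \o xsection N) x = \int[m1]_x `|(m2 \o xsection N) x|.
  by apply: eq_integral => x _; rewrite gee0_abs.
move/(ae_eq_integral_abs m1 measurableT mx).
by apply: filterS => x /(_ I).
Qed.

End null_sections.

Section isoperimetric.
Context {R : realType} {d : nat}.
Local Open Scope ereal_scope.
Local Notation mu := (lebesgue_rV R d).
Local Notation leb := (@lebesgue_measure R).
Local Notation B := (@unit_ball R d).
Variables (u : 'rV[R]_d -> R) (Du : 'rV[R]_d -> 'rV[R]_d).
Hypotheses (uL2 : L2 B u) (wu : L2_weak_gradient B u Du).
Implicit Types (h x : 'rV[R]_d) (a b s t : R).

Let w : 'rV[R]_d -> R := u \_ B.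
Let mw : measurable_fun setT w := L2_measurable uL2.
Let mB : measurable B := measurable_unit_ball.

Lemma measurable_dir_grad h : measurable_fun setT (dir_grad Du h).
Proof.
by apply/measurable_EFinP; exact: measurable_int (dir_grad_integrable h wu.1).
Qed.

(** Exchange of quantifiers by Fubini: the exceptional set of pairs (x, s) is
    measurable and its sections at fixed s are null, so almost all its sections
    at fixed x are null. *)
Lemma ae_line_identity h :
  {ae mu, forall x, B x -> B (x + h)%R -> {ae leb, forall s, s \in `[0, 1]%R ->
    (w (x + s *: h) = w x + line_integral (dir_grad Du h) h s x)%R}}.
Proof.
pose N : set ('rV[R]_d * measurableTypeR R) := [set p |
  [/\ B p.1, B (p.1 + h)%R, `[0%R, 1%R]%classic p.2 &
  (w (p.1 + p.2 *: h) != w p.1 + line_integral (dir_grad Du h) h p.2 p.1)%R]].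
have mN : measurable N.
  rewrite (_ : N = (fst @^-1` B) `&` ((fun p => p.1 + h)%R @^-1` B) `&`
      (snd @^-1` `[0%R, 1%R]) `&` ~` ((fun p =>
      w (p.1 + p.2 *: h) == w p.1 + line_integral (dir_grad Du h) h p.2 p.1)%R @^-1` [set true])).
    apply: measurableI; first (apply: measurableI; first apply: measurableI).
    - by rewrite -[X in measurable X]setTI; apply: measurable_fst.
    - rewrite -[X in measurable X]setTI.
      by apply: (measurableT_comp (measurable_rV_shift h) measurable_fst).
    - by rewrite -[X in measurable X]setTI; apply: measurable_snd.
    - apply: measurableC; rewrite -[X in measurable X]setTI.
      apply: measurable_fun_eqr => //.
        exact: (measurableT_comp mw (measurable_line h)).
      apply: measurable_funD; first exact: (measurableT_comp mw measurable_fst).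
      exact: measurable_line_integral (measurable_dir_grad h).
  apply/seteqP; split => p /=.
    by move=> [? ? ? /negP].
  by move=> [[[? ?] ?] /negP].
have N0 s : mu (ysection N s) = 0.
  have [s01|s01] := boolP (s \in `[0, 1]%R); last first.
    rewrite (_ : ysection N s = set0) ?measure0//.
    apply/seteqP; split => x //; rewrite /ysection /= inE => -[_ _ /=].
    by rewrite (negbTE s01).
  apply/negligibleP; first exact: measurable_ysection.
  apply: negligibleS (line_identity h uL2 wu s01) => x.
  rewrite /ysection /= inE => -[/= Bx Bxh _ /eqP neq] /(_ Bx Bxh) idx.
  by apply: neq; rewrite -idx subrKC.
have nullx := @ae_null_xsection _ _ _ _ _ mu leb _ mN N0.
apply: (filterS _ nullx) => x Nx0 Bx Bxh.
have mNx : measurable (xsection N x) by exact: measurable_xsection.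
exists (xsection N x); split => // s /= /not_implyP[s01 /eqP neq].
by rewrite /xsection /= inE; split.
Qed.

Definition band (a b : R) (f : 'rV[R]_d -> R) x : R := if (a < w x < b)%R then f x else 0%R.

Lemma measurable_band a b f : measurable_fun setT f -> measurable_fun setT (band a b f).
Proof.
move=> mf; apply: measurable_fun_ifT => //.
by apply: measurable_and; apply: measurable_fun_ltr.
Qed.

Lemma ae_crossing h a b : (a < b)%R ->
  {ae mu, forall x, B x -> B (x + h)%R -> (w x <= a)%R -> (b <= w (x + h))%R ->
    (b - a)%:E <= \int[leb]_(s in `[0%R, 1%R])
       (band a b (fun y => `|dir_grad Du h y|%R) (x + s *: h)%R)%:E}.
Proof.
move=> ab.
have ig := dir_grad_integrable h wu.1.
have mg := measurable_dir_grad h.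
have s1 : (0 <= (1 : R) <= 1)%R by apply/andP; split => //; exact: ler01.
have id1 := line_identity h uL2 wu s1.
have int_ae := ae_integrable_line h ler01 ig.
apply: (filterS3 _ _ (ae_line_identity h) int_ae id1) => x line_x int_x line1 Bx Bxh wa wb.
apply: (@crossing_le _ (fun t => dir_grad Du h (x + t *: h)) (fun t => w (x + t *: h)) (w x)) => //.
- exact: (measurableT_comp mw (measurableT_comp (measurable_line h) (pair1_measurable x))).
- exact: line_x.
- have eb : (w (x + h) = w x + line_integral (dir_grad Du h) h 1 x)%R.
    by rewrite -(line1 Bx Bxh) scale1r subrKC.
  by rewrite eb in wb.
Qed.

Definition low a : set 'rV[R]_d := [set x | u x <= a]%R `&` B.
Definition high b : set 'rV[R]_d := [set x | b <= u x]%R `&` B.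

Lemma measurable_low a : measurable (low a).
Proof.
rewrite (_ : low a = w @^-1` `]-oo, a] `&` B).
  by apply: measurableI => //; rewrite -[X in measurable X]setTI; exact: mw.
by apply/seteqP; split => x [/= ux Bx]; split => //; move: ux;
  rewrite /w /= in_itv/= patchE mem_set.
Qed.

Lemma measurable_high b : measurable (high b).
Proof.
rewrite (_ : high b = w @^-1` `[b, +oo[ `&` B).
  by apply: measurableI => //; rewrite -[X in measurable X]setTI; exact: mw.
by apply/seteqP; split => x [/= ux Bx]; split => //; move: ux;
  rewrite /w /= in_itv/= patchE mem_set// andbT.
Qed.

(** The lower bound of [ae_crossing] is integrated over x; once the order of
    integration is exchanged, translation invariance makes the space integral
    independent of the time. *)
Lemma translate_bound h a b : (a < b)%R ->
  (b - a)%:E * mu (low a `&` (fun x => x + h)%R @^-1` high b) <=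
  \int[mu]_x (band a b (fun y => `|dir_grad Du h y|%R) x)%:E.
Proof.
move=> ab; set S := _ `&` _; pose T := band a b (fun y => `|dir_grad Du h y|%R).
have mS : measurable S.
  apply: measurableI; first exact: measurable_low.
  rewrite -[X in measurable X]setTI.
  by apply: (measurable_rV_shift h) => //; exact: measurable_high.
have mT : measurable_fun setT T.
  by apply: measurable_band; apply: measurableT_comp => //; exact: measurable_dir_grad.
have T0 x : (0 <= T x)%R by rewrite /T /band; case: ifP.
pose K (p : 'rV[R]_d * measurableTypeR R) := (T (p.1 + p.2 *: h) * \1_`[0%R, 1%R] p.2)%:E.
have mK : measurable_fun setT K.
  apply/measurable_EFinP; apply: measurable_funM.
    exact: (measurableT_comp mT (measurable_line h)).
  by apply: (@measurable_indic_segment _ _ _ snd (cst 1%R)) => //; exact: measurable_snd.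
have K0 p : 0 <= K p by rewrite lee_fin mulr_ge0.
have mKx : measurable_fun setT (fun x => \int[leb]_s K (x, s)).
  exact: (measurable_fun_fubini_tonelli_F K mK K0).
have Kx0 x : 0 <= \int[leb]_s K (x, s) by apply: integral_ge0.
rewrite -integral_cst//.
apply: (@le_trans _ _ (\int[mu]_(x in S) \int[leb]_s K (x, s))).
  apply: ae_ge0_le_integral => //.
  - by move=> x _; rewrite lee_fin subr_ge0 ltW.
  - exact: measurable_funTS.
  - apply: filterS (ae_crossing h ab) => x hx [[/= ua Bx] [/= ub Bxh]].
    rewrite /K -(integral_indicM leb (fun s => T (x + s *: h)%R))//.
    by apply: hx => //; rewrite /w patchE mem_set.
apply: (@le_trans _ _ (\int[mu]_x \int[leb]_s K (x, s))).
  exact: ge0_subset_integral.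
rewrite fubini_tonelli//.
have -> : \int[leb]_s \int[mu]_x K (x, s) =
    \int[leb]_(s in `[0%R, 1%R]) cst (\int[mu]_x (T x)%:E) s.
  rewrite [RHS]integral_mkcond; apply: eq_integral.
  move=> s _; rewrite /K patchE/= indicE; case: ifPn => s01.
    under eq_integral do rewrite mulr1.
    apply: (@ge0_integral_rV_shift _ _ (s *: h) (EFin \o T)) => //.
    by apply/measurable_EFinP.
  by rewrite integral0_eq// => x _; rewrite mulr0.
have leb01 : leb `[0%R, 1%R] = 1.
  by rewrite lebesgue_measure_itv/= lte_fin ltr01 -EFinB subr0.
by rewrite (integral_cst leb)//= [X in _ * X <= _]leb01 mule1.
Qed.

Lemma enorm_patchE x : ((fun y => enorm (Du y)) \_ B) x =
  Num.sqrt (\sum_(i < d) ((fun y => Du y ord0 i) \_ B) x ^+ 2)%R.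
Proof.
rewrite patchE; case: ifPn => xB.
  by rewrite /enorm; congr Num.sqrt; apply: eq_bigr => i _; rewrite patchE xB.
rewrite big1 ?sqrtr0// => i _.
by rewrite patchE (negbTE xB) expr0n.
Qed.

Lemma measurable_enorm_grad : measurable_fun setT ((fun y => enorm (Du y)) \_ B).
Proof.
rewrite (funext enorm_patchE).
have msqrt : measurable_fun setT (@Num.sqrt R).
  by apply: continuous_measurable_fun; exact: sqrt_continuous.
apply: (measurableT_comp msqrt); apply: measurable_sum => i.
by apply: measurable_funX; exact: L2_measurable (wu.1 i).
Qed.

(** A crude bound, each |Du_i| being at most |Du|: the constant only has to
    depend on the dimension. *)
Lemma dir_grad_le h x : cube 2 h ->
  (`|dir_grad Du h x| <= d%:R * 2 * ((fun y => enorm (Du y)) \_ B) x)%R.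
Proof.
move=> hc; rewrite /dir_grad; apply: le_trans (ler_norm_sum _ _ _) _.
rewrite -mulrA mulr_natl -[X in (_ <= _ *+ X)%R]card_ord -sumr_const.
apply: ler_sum => i _; rewrite normrM; apply: ler_pM => //.
  by rewrite ler_norml; have := hc i; rewrite /= in_itv.
rewrite enorm_patchE -sqrtr_sqr ler_sqrt; last by apply: sumr_ge0 => j _; exact: sqr_ge0.
by rewrite (bigD1 i)//= lerDl; apply: sumr_ge0 => j _; exact: sqr_ge0.
Qed.

(** By Fubini and translation invariance, |low| |high| is the integral over h
    of |{x in low : x + h in high}|.  Both sets lie in the unit ball, so only
    the h in [-2, 2]^d contribute. *)
Lemma low_high_bound a b : (a < b)%R ->
  (b - a)%:E * (mu (low a) * mu (high b)) <=
  mu (cube 2) * ((d%:R * 2)%:E *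
    \int[mu]_x (band a b ((fun y => enorm (Du y)) \_ B) x)%:E).
Proof.
move=> ab.
pose N : set ('rV[R]_d * 'rV[R]_d) := [set p | low a p.1 /\ high b (p.1 + p.2)%R].
have mlow := measurable_low a; have mhigh := measurable_high b.
have mD : measurable_fun setT (fun p : 'rV[R]_d * 'rV[R]_d => (p.1 + p.2)%R).
  apply: measurable_fun_rVP => i; under eq_fun do rewrite !mxE.
  by apply: measurable_funD; apply: (measurableT_comp (@measurable_coord R d i));
    [exact: measurable_fst|exact: measurable_snd].
have mN : measurable N.
  rewrite (_ : N = (fst @^-1` low a) `&` ((fun p => p.1 + p.2)%R @^-1` high b))//.
  apply: measurableI; rewrite -[X in measurable X]setTI.
    by apply: measurable_fst.
  exact: mD.
have -> : mu (low a) * mu (high b) = \int[mu]_h mu (ysection N h).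
  (* Sections at fixed x are translates of high b, or empty off low a. *)
  transitivity (\int[mu]_x mu (xsection N x)); last first.
    have := indic_fubini_tonelli mu mu mN.
    by rewrite indic_fubini_tonelli_FE// indic_fubini_tonelli_GE.
  rewrite muleC -integral_cst// integral_mkcond; apply: eq_integral => x _.
  rewrite patchE; case: ifPn => [/set_mem lx|/negP lx].
    rewrite -(lebesgue_rV_shift x mhigh) /pushforward; congr (mu _).
    apply/seteqP; split => h; rewrite /xsection /= inE /N /= addrC //.
    by move=> [].
  rewrite (_ : xsection N x = set0) ?measure0//; apply/seteqP; split => h //.
  by rewrite /xsection /= inE => -[/= /mem_set].
set V := band _ _ _.
have mV : measurable_fun setT V by apply: measurable_band; exact: measurable_enorm_grad.
have V0 x : (0 <= V x)%R.
  by rewrite /V /band; case: ifP => // _; rewrite enorm_patchE sqrtr_ge0.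
have IV0 : 0 <= \int[mu]_x (V x)%:E by apply: integral_ge0 => x _; rewrite lee_fin.
have b_a : (0 <= b - a)%R by rewrite subr_ge0 ltW.
have mNy : measurable_fun setT (fun h => mu (ysection N h)).
  exact: measurable_fun_ysection.
rewrite -ge0_integralZl_EFin//.
rewrite [leRHS]muleC -integral_cst//; last exact: measurable_cube.
rewrite [leRHS]integral_mkcond; apply: ge0_le_integral => //.
- by move=> h _; apply: mule_ge0.
- exact: measurable_funeM.
- by apply/(measurable_restrictT _ (measurable_cube 2)).
move=> h _; rewrite patchE.
have -> : ysection N h = low a `&` (fun x => x + h)%R @^-1` high b.
  by apply/seteqP; split => x; rewrite /ysection /= inE.
case: ifPn => [/set_mem hc|/negP hc].
  apply: le_trans (translate_bound h ab) _.
  rewrite -ge0_integralZl_EFin//; last 2 first.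
  - by move=> x _; rewrite lee_fin.
  - by apply/measurable_EFinP.
  apply: ge0_le_integral => //.
  - by move=> x _; rewrite lee_fin /band; case: ifP.
  - apply/measurable_EFinP; apply: measurable_band; apply: measurableT_comp => //.
    exact: measurable_dir_grad.
  - by apply: measurable_funeM; apply/measurable_EFinP.
  - move=> x _; rewrite -EFinM lee_fin /V /band; case: ifP => _; last by rewrite mulr0.
    exact: dir_grad_le.
rewrite (_ : _ `&` _ = set0) ?measure0 ?mule0//.
apply/seteqP; split => x //= [[_ /unit_ball_cube Bx] [_ /unit_ball_cube Bxh]].
apply: hc; apply: mem_set => i; have := Bx i; have := Bxh i.
rewrite /= !in_itv/= mxE => /andP[? ?] /andP[? ?]; apply/andP; split; lra.
Qed.

Lemma band_hoelder a b :
  \int[mu]_x (band a b ((fun y => enorm (Du y)) \_ B) x)%:E <=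
  L2norm B (fun x => enorm (Du x)) *
    mu ([set x | (a < u x < b)%R] `&` B) `^ (1 / 2).
Proof.
set S := _ `&` B.
have mS : measurable S.
  rewrite (_ : S = w @^-1` `]a, b[ `&` B).
    by apply: measurableI => //; rewrite -[X in measurable X]setTI; exact: mw.
  by apply/seteqP; split => x [/= ux Bx]; split => //; move: ux;
    rewrite /w /= in_itv/= patchE mem_set.
pose E := (fun y => enorm (Du y)) \_ B.
have E0 x : (0 <= E x)%R by rewrite /E enorm_patchE sqrtr_ge0.
have normS : Lnorm mu 2%:E (EFin \o \1_S) = mu S `^ (1 / 2).
  rewrite unlock /= div1r; congr (_ `^ _).
  rewrite -[S in RHS]setIT -integral_indic//; apply: eq_integral => x _ /=.
  by rewrite indicE; case: (_ \in _); rewrite ?normr1 ?powR1// normr0 powR0.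
rewrite /L2norm -/E -normS.
have half : (2^-1 + 2^-1 = 1 :> R)%R by lra.
have holder := @hoelder _ _ _ mu E \1_S 2 2 measurable_enorm_grad
  (measurable_indic mS) (ltr0Sn _ _) (ltr0Sn _ _) half.
refine (le_trans _ holder).
rewrite Lnorm1; apply: ge0_le_integral => //.
- by move=> x _; rewrite lee_fin /band; case: ifP.
- apply/measurable_EFinP; apply: measurable_band; exact: measurable_enorm_grad.
- apply: measurableT_comp => //; apply/measurable_EFinP; apply: measurable_funM.
    exact: measurable_enorm_grad.
  exact: measurable_indic.
- move=> x _; rewrite lee_fin /= -/E; apply: le_trans (ler_norm _).
  rewrite /band indicE; case: ifPn => wab; last by rewrite mulr_ge0.
  have [xB|/negP xB] := boolP (x \in B).
    rewrite mem_set ?mulr1//; split; last exact: set_mem.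
    by move: wab; rewrite /w patchE xB.
  by rewrite {1}/E patchE ifF ?mulr_ge0//; exact/negbTE/negP.
Qed.

End isoperimetric.

Unset Implicit Arguments.

Theorem lemma2p2p7 (R : realType) (d : nat) (hd : (1 <= d)%N) :
  exists C : R, 0 < C /\
    forall u : 'rV[R]_d -> R, H1 (unit_ball d) u ->
    forall Du : 'rV[R]_d -> 'rV[R]_d, L2_weak_gradient (unit_ball d) u Du ->
    (lebesgue_rV R d ([set x | (u x <= 1 / 2)%R] `&` unit_ball d) *
       lebesgue_rV R d ([set x | (1 <= u x)%R] `&` unit_ball d) <=
     C%:E * L2norm (unit_ball d) (fun x => enorm (Du x)) *
       lebesgue_rV R d ([set x | (1 / 2 < u x < 1)%R] `&` unit_ball d) `^ (1 / 2))%E.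
Proof.
pose c := fine (lebesgue_rV R d (cube 2)).
have c0 : 0 <= c by exact: fine_ge0.
have cE : lebesgue_rV R d (cube 2) = c%:E by rewrite fineK// ge0_fin_numE// cube_lty.
have C0 : 0 <= 2 * (c * (d%:R * 2)) by rewrite !mulr_ge0.
(* The factor 2 is 1 / (b - a) for the levels b = 1 and a = 1 / 2; adding 1
   makes positivity immediate. *)
exists (2 * (c * (d%:R * 2)) + 1); split; first by rewrite ltr_wpDl.
move=> u [uL2 _] Du wu.
have half1 : (1 / 2 < 1 :> R) by lra.
have iso := low_high_bound uL2 wu half1.
rewrite -muleA; apply: (@le_trans _ _ ((2 * (c * (d%:R * 2)) + 1)%:E *
    \int[lebesgue_rV R d]_x
       (band u (1 / 2) 1 ((fun y => enorm (Du y)) \_ (unit_ball d)) x)%:E)%E); last first.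
  apply: lee_wpmul2l; first by rewrite lee_fin addr_ge0.
  exact: band_hoelder.
move: iso; rewrite /low /high cE; set X := (_ * lebesgue_rV R d _)%E; set Y := (\int[_]_x _)%E.
have Y0 : (0 <= Y)%E.
  apply: integral_ge0 => x _; rewrite lee_fin /band enorm_patchE.
  by case: ifP => // _; exact: sqrtr_ge0.
move=> iso.
have -> : X = (2%:E * ((1 - 1 / 2)%:E * X))%E.
  by rewrite muleA -EFinM (_ : 2 * _ = 1) ?mul1e//; lra.
apply: (le_trans (lee_wpmul2l _ iso)); first by rewrite lee_fin.
rewrite !muleA -!EFinM; apply: lee_wpmul2r => //.
by rewrite lee_fin !mulrA lerDl.
Qed.
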